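(* Let $(\alpha_n)$ be a Riemann sequence and let $$\Xi_\alpha(t)=\Xi_\alpha(0)\prod_{n=1}^\infty\Bigl(1-\frac{t^2}{\alpha_n^2}\Bigr)$$ be the associated function, with the constant $\Xi_\alpha(0)$ as defined in the context. Then $\Xi_\alpha(t)$ is an even entire function of order $1$. Its zeros are the numbers $\alpha_n$ and $-\alpha_n$. Moreover $\Xi_\alpha(t)$ is real for $t$ real and for $t$ purely imaginary.
   Context: Asymptotic notation: for a function $f(z)$ defined on a half-plane $\operatorname{Re}z>a$, one writes $f(z)\simeq\sum_{n=0}^\infty\frac{b_n}{z^n}$ if for each natural number $N$ and any $0<\varepsilon<\frac{\pi}{2}$ we have $\lim_{z\to\infty}\bigl(f(z)-\sum_{n=0}^N\frac{b_n}{z^n}\bigr)z^N=0$ for $|\arg z|\le\frac{\pi}{2}-\varepsilon$; and $f\simeq g+\sum_n b_nz^{-n}$ means $f-g\simeq\sum_n b_nz^{-n}$. Coefficients: $a_{2n+1}=\frac{8-E_{2n}}{2^{2n+2}}$ ($n\ge0$), $a_{2n}=\bigl(1-\frac{1}{2^{2n-1}}\bigr)\frac{B_{2n}}{4n}$ ($n\ge1$), with $\frac{2e^t}{e^{2t}+1}=\sum_{n\ge0} E_n\frac{t^n}{n!}$, $\frac{t}{e^t-1}=\sum_{n\ge0} B_n\frac{t^n}{n!}$. Riemann sequence: a sequence of complex numbers $(\alpha_n)_{n\ge1}$ is a Riemann sequence if: (a) $1<\operatorname{Re}\alpha_1\le\operatorname{Re}\alpha_2\le\cdots$; (b) each complex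 number $\alpha$ has finite multiplicity $\nu(\alpha)=\operatorname{card}\{n:\alpha_n=\alpha\}$, and $\nu(\alpha)=\nu(\overline\alpha)$ if $\alpha$ is not real; (c) there is a constant $C$ with $|\operatorname{Im}\alpha_n|<C$ for all $n$; (d) $|\arg\alpha_n|<\pi/4$, i.e. $|\operatorname{Im}\alpha_n|<\operatorname{Re}\alpha_n$, for all $n$; (e) $\sum_{k=1}^\infty\frac{2z}{z^2+\alpha_k^2}\simeq\frac12\log\frac{z}{2\pi}+\sum_{n=1}^\infty\frac{a_n}{z^n}$. The constant $\Xi_\alpha(0)$: for a Riemann sequence the limit $B=\lim_{x\to+\infty}\bigl\{\sum_{n}\log(1+\frac{x^2}{\alpha_n^2})-\frac x2\log\frac{x}{2\pi}+\frac x2-\frac74\log x\bigr\}$ (principal logarithms) exists and is real, and $\Xi_\alpha(0)$ is the positive real number defined by $B=\frac14\log\frac\pi2-\log\Xi_\alpha(0)$. *)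

(* Defs.v *)
(* Sequences (alpha_n), n >= 1, are encoded as
   functions nat -> C with alpha k standing for alpha_(k+1). *)
From Stdlib Require Import Factorial Reals List.
From Coquelicot Require Import Coquelicot.
Open Scope R_scope.
Open Scope C_scope.

(* Principal argument, with values in (-PI, PI]; only meaningful for z <> 0. *)
Definition Carg (z : C) : R :=
  if Rle_dec 0 (Im z) then acos (Re z / Cmod z)%R else (- acos (Re z / Cmod z))%R.

Definition Clog (z : C) : C := (ln (Cmod z), Carg z).

Definition Clim {T : Type} (F : (T -> Prop) -> Prop) (f : T -> C) : C :=
  iota (T := CompleteNormedModule.CompleteSpace C_AbsRing C_CompleteNormedModule)
    (fun l => filterlim f F (locally (T := C_UniformSpace) l)).

Definition Csum (u : nat -> C) (n : nat) : C := sum_n (G := C_AbelianMonoid) u n.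

Definition Cseries (u : nat -> C) : C := Clim eventually (Csum u).

Fixpoint Cprod (u : nat -> C) (n : nat) : C :=
  match n with
  | O => 1
  | S m => Cprod u m * u m
  end.

Definition entire (f : C -> C) : Prop :=
  forall z : C, ex_derive (K := C_AbsRing) (V := C_NormedModule) f z.

(* f(z) = O(exp(|z|^m)) as |z| -> oo *)
Definition exp_growth (f : C -> C) (m : R) : Prop :=
  exists K M : R, (0 < M)%R /\
    forall z : C, (M <= Cmod z)%R ->
      (Cmod (f z) <= K * exp (Rpower (Cmod z) m))%R.

Definition entire_order (f : C -> C) : Rbar :=
  Glb_Rbar (fun m : R => (0 <= m)%R /\ exp_growth f m).

(* f(z) = (z - a)^m g(z) with g entire and g(a) <> 0; m = 0 means f(a) <> 0. *)
Definition zero_multiplicity (f : C -> C) (a : C) (m : nat) : Prop :=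
  exists g : C -> C,
    entire g /\ g a <> 0 /\ forall z : C, f z = (z - a) ^ m * g z.

Definition has_card (P : nat -> Prop) (m : nat) : Prop :=
  exists l : list nat, NoDup l /\ length l = m /\ forall n, In n l <-> P n.

Definition Cinfty (P : C -> Prop) : Prop :=
  exists M : R, forall z : C, (M < Cmod z)%R -> P z.

(* The expansion f(z) ~ sum_n b_n / z^n at infinity, in every closed sector
   smaller than the right half-plane. *)
Definition asymptotic_expansion (f : C -> C) (b : nat -> C) : Prop :=
  forall (N : nat) (eps : R), (0 < eps < PI / 2)%R ->
    filterlim (fun z : C => (f z - Csum (fun n => b n / z ^ n) N) * z ^ N)
      (within (fun z : C => (Rabs (Carg z) <= PI / 2 - eps)%R) Cinfty)
      (locally (T := C_UniformSpace) (RtoC 0)).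

Definition euler_numbers (E : nat -> R) : Prop :=
  locally (0 : R) (fun t : R =>
    is_pseries (fun n => E n / INR (fact n))%R t
      (2 * exp t / (exp (2 * t) + 1))%R).

Definition bernoulli_numbers (B : nat -> R) : Prop :=
  locally' (0 : R) (fun t : R =>
    is_pseries (fun n => B n / INR (fact n))%R t (t / (exp t - 1))%R).

(* a_0 = 0, since the expansion in condition (e) starts at n = 1. *)
Definition xi_coef (E B : nat -> R) (n : nat) : R :=
  match n with
  | O => 0
  | _ => let m := Nat.div2 n in
         if Nat.even n
         then (1 - 1 / 2 ^ (2 * m - 1)) * (B (2 * m)%nat / (4 * INR m))
         else (8 - E (2 * m)%nat) / 2 ^ (2 * m + 2)
  end%R.

Definition riemann_expansion (alpha : nat -> C) : Prop :=
  exists E B : nat -> R, euler_numbers E /\ bernoulli_numbers B /\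
  exists (a : R) (S : C -> C),
    (forall z : C, (a < Re z)%R ->
       filterlim (Csum (fun k => 2 * z / (z ^ 2 + alpha k ^ 2))) eventually
         (locally (T := C_UniformSpace) (S z))) /\
    asymptotic_expansion
      (fun z => S z - 1 / 2 * Clog (z / (2 * PI)))
      (fun n => RtoC (xi_coef E B n)).

Record riemann_sequence (alpha : nat -> C) : Prop := {
  riemann_gt1 : (1 < Re (alpha 0%nat))%R;
  riemann_mono : forall n, (Re (alpha n) <= Re (alpha (S n)))%R;
  riemann_finite_mult : forall a : C,
    exists m, has_card (fun n => alpha n = a) m;
  riemann_conj_mult : forall (a : C) (m : nat), Im a <> 0%R ->
    has_card (fun n => alpha n = a) m ->
    has_card (fun n => alpha n = Cconj a) m;
  riemann_Im_bounded : exists M : R, forall n, (Rabs (Im (alpha n)) < M)%R;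
  riemann_arg : forall n, (Rabs (Im (alpha n)) < Re (alpha n))%R;
  riemann_asymptotic : riemann_expansion alpha
}.

(* The limit B; it exists and is real when alpha is a Riemann sequence. *)
Definition xi_limit (alpha : nat -> C) : C :=
  Clim (Rbar_locally p_infty) (fun x : R =>
    Cseries (fun n => Clog (1 + x ^ 2 / alpha n ^ 2))
    - RtoC (x / 2 * ln (x / (2 * PI)))%R + RtoC (x / 2)%R
    - RtoC (7 / 4 * ln x)%R).

(* Xi_alpha(0) > 0, solved from  B = (1/4) log(PI/2) - log Xi_alpha(0). *)
Definition Xi0 (alpha : nat -> C) : R :=
  exp (1 / 4 * ln (PI / 2) - Re (xi_limit alpha))%R.

Definition xi_factor (alpha : nat -> C) (t : C) (n : nat) : C :=
  1 - t ^ 2 / alpha n ^ 2.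

Definition Xi (alpha : nat -> C) (t : C) : C :=
  Xi0 alpha * Clim eventually (Cprod (xi_factor alpha t)).

(* Main.v *)
(* Put c_k = -1/alpha_k^2, so that Xi_alpha(t) = Xi_alpha(0) P(t^2) with
   P(w) = prod (1 + c_k w).  For x > 0 large, condition (e) on the real axis
   reads  Re sum_k 2x/(x^2 + alpha_k^2) = (1/2) log(x/(2 PI)) + o(1), and since
   Re alpha_k^2 > 0 every term is positive and comparable with
   2x |c_k| / (1 + |c_k| x^2), the derivative of log(1 + |c_k| x^2).  Hence
   sum |c_k| converges, and log prod (1 + |c_k| x^2) = O(x log x), which gives
   order <= 1.  On the imaginary axis log |1 + y^2/alpha_k^2| is at least
   (y/4) Re(2y/(y^2 + alpha_k^2)), so |Xi_alpha(iy)| >= exp(y) for y large,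
   up to a constant, and the order is >= 1.  For the reality, cut the product
   where Re alpha_n jumps: such a partial product runs over a multiset stable
   under conjugation. *)
Require Import Defs.
From Stdlib Require Import Reals List Lra Lia Permutation Classical.
From Coquelicot Require Import Coquelicot.
Open Scope R_scope.
Open Scope C_scope.

(** * Convergence of complex sequences and domination by real sums *)

Definition Cseq_lim (u : nat -> C) (l : C) : Prop :=
  forall eps : R, (0 < eps)%R ->
    exists N, forall n, (N <= n)%nat -> (Cmod (u n - l) < eps)%R.

(** The neighbourhoods of [C_UniformSpace] are squares; a square of half-side r contains the disc of
    radius r and lies in the disc of radius r sqrt 2. *)
Lemma Cseq_limE (u : nat -> C) (l : C) :
  filterlim u eventually (locally (T := C_UniformSpace) l) <-> Cseq_lim u l.
Proof.
split.
- intros H eps Heps.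
  assert (He : (0 < eps / sqrt 2)%R)
    by (apply Rdiv_lt_0_compat; [easy | apply sqrt_lt_R0; lra]).
  destruct (proj1 (@filterlim_locally _ C_UniformSpace _ _ u l) H
    (mkposreal _ He)) as [N HN].
  exists N; intros n Hn.
  apply (Rlt_le_trans _ _ _
    (C_NormedModule_mixin_compat2 l (u n) (mkposreal _ He) (HN n Hn))).
  simpl; right; field; apply Rgt_not_eq, sqrt_lt_R0; lra.
- intros H; apply (@filterlim_locally _ C_UniformSpace _ _ u l); intros eps.
  destruct (H eps (cond_pos eps)) as [N HN].
  exists N; intros n Hn; apply C_NormedModule_mixin_compat1, HN, Hn.
Qed.

Lemma Cseq_lim_unique (u : nat -> C) (l l' : C) :
  Cseq_lim u l -> Cseq_lim u l' -> l = l'.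
Proof.
intros H H'.
apply (@filterlim_locally_unique nat C_AbsRing C_NormedModule eventually _ u);
  now apply Cseq_limE.
Qed.

Lemma Clim_seq_unique (u : nat -> C) (l : C) :
  Cseq_lim u l -> Clim eventually u = l.
Proof.
intros H; unfold Clim.
apply (iota_unique (V := C_CompleteNormedModule)).
- intros y Hy; apply (Cseq_lim_unique u); [now apply Cseq_limE | easy].
- now apply Cseq_limE.
Qed.

Lemma Cseq_lim_scal (u : nat -> C) (l a : C) :
  Cseq_lim u l -> Cseq_lim (fun n => a * u n) (a * l).
Proof.
intros H eps Heps.
pose proof (Cmod_ge_0 a) as Ha.
(* The summand 1 covers the case a = 0. *)
destruct (H (eps / (Cmod a + 1))%R) as [N HN].
{ apply Rdiv_lt_0_compat; lra. }
exists N; intros n Hn; specialize (HN n Hn).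
replace (a * u n - a * l) with (a * (u n - l)) by ring.
rewrite Cmod_mult.
apply Rle_lt_trans with ((Cmod a) * (eps / (Cmod a + 1)))%R.
- apply Rmult_le_compat_l; lra.
- apply Rmult_lt_reg_r with (Cmod a + 1)%R; [lra |].
  replace (Cmod a * (eps / (Cmod a + 1)) * (Cmod a + 1))%R
    with (Cmod a * eps)%R by (field; lra).
  nra.
Qed.

Lemma Cseq_lim_eventually_eq (u v : nat -> C) (l : C) (N : nat) :
  (forall n, (N <= n)%nat -> u n = v n) -> Cseq_lim u l -> Cseq_lim v l.
Proof.
intros E H eps Heps.
destruct (H eps Heps) as [N' HN].
exists (Nat.max N N'); intros n Hn.
rewrite <- E by lia; apply HN; lia.
Qed.

Lemma Cmod_triangle_inv (x y : C) : (Cmod x - Cmod y <= Cmod (x - y))%R.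
Proof.
pose proof (Cmod_triangle (x - y) y) as H.
replace (x - y + y) with x in H by ring; lra.
Qed.

Lemma Cseq_lim_Cmod_le (u : nat -> C) (l : C) (M : R) (N : nat) :
  (forall n, (N <= n)%nat -> (Cmod (u n) <= M)%R) ->
  Cseq_lim u l -> (Cmod l <= M)%R.
Proof.
intros B H; apply Rnot_lt_le; intros Hlt.
destruct (H (Cmod l - M)%R) as [N' HN]; [lra |].
specialize (HN (Nat.max N N') ltac:(lia)).
specialize (B (Nat.max N N') ltac:(lia)).
pose proof (Cmod_triangle_inv l (u (Nat.max N N'))) as T.
replace (l - u (Nat.max N N')) with (- (u (Nat.max N N') - l)) in T by ring.
rewrite Cmod_opp in T; lra.
Qed.

Lemma Cseq_lim_Cmod_ge (u : nat -> C) (l : C) (M : R) (N : nat) :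
  (forall n, (N <= n)%nat -> (M <= Cmod (u n))%R) ->
  Cseq_lim u l -> (M <= Cmod l)%R.
Proof.
intros B H; apply Rnot_lt_le; intros Hlt.
destruct (H (M - Cmod l)%R) as [N' HN]; [lra |].
specialize (HN (Nat.max N N') ltac:(lia)).
specialize (B (Nat.max N N') ltac:(lia)).
pose proof (Cmod_triangle_inv (u (Nat.max N N')) l) as T.
lra.
Qed.

Lemma exp_monotone (x y : R) : (x <= y)%R -> (exp x <= exp y)%R.
Proof.
intros [H | ->]; [left; now apply exp_increasing | lra].
Qed.

(** Only indices below n count, in step with [Cprod], whereas [Csum u n] includes the index n. *)
Fixpoint rsum (a : nat -> R) (n : nat) : R :=
  match n with O => 0%R | S m => (rsum a m + a m)%R end.

Lemma rsum_ge0 (a : nat -> R) (n : nat) :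
  (forall k, (0 <= a k)%R) -> (0 <= rsum a n)%R.
Proof.
intros H; induction n as [|n IH]; simpl; [lra |].
specialize (H n); lra.
Qed.

Lemma rsum_le (a b : nat -> R) (n : nat) :
  (forall k, (a k <= b k)%R) -> (rsum a n <= rsum b n)%R.
Proof.
intros H; induction n as [|n IH]; simpl; [lra |].
specialize (H n); lra.
Qed.

Lemma rsum_scal (x : R) (a : nat -> R) (n : nat) :
  rsum (fun k => (x * a k)%R) n = (x * rsum a n)%R.
Proof. induction n as [|n IH]; simpl; [ring | rewrite IH; ring]. Qed.

Lemma rsum_incr (a : nat -> R) (n m : nat) :
  (forall k, (0 <= a k)%R) -> (n <= m)%nat -> (rsum a n <= rsum a m)%R.
Proof.
intros H Hnm; induction Hnm as [|m Hnm IH]; simpl; [lra |].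
specialize (H m); lra.
Qed.

Definition summable (c : nat -> C) : Prop :=
  exists M : R, forall n, (rsum (fun k => Cmod (c k)) n <= M)%R.

Lemma rsum_cauchy (a : nat -> R) (M : R) :
  (forall k, (0 <= a k)%R) -> (forall n, (rsum a n <= M)%R) ->
  forall eps : R, (0 < eps)%R ->
    exists N, forall n, (N <= n)%nat -> (rsum a n - rsum a N < eps)%R.
Proof.
intros H B eps Heps.
assert (G : Un_growing (rsum a)) by (intros n; simpl; specialize (H n); lra).
destruct (growing_cv (rsum a) G) as [l Hl].
{ exists M; intros x [n ->]; apply B. }
destruct (Hl (eps / 2)%R ltac:(lra)) as [N HN].
exists N; intros n Hn.
pose proof (HN n Hn) as H1; pose proof (HN N (le_n N)) as H2.
unfold Rdist in *; apply Rabs_def2 in H1, H2; lra.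
Qed.

(** Domination by a convergent series makes the sequence Cauchy; completeness of R then gives the
    limits of the real and imaginary parts separately. *)
Lemma Cseq_lim_of_increments (u : nat -> C) (a : nat -> R) (M : R) :
  (forall n, (Cmod (u (S n) - u n) <= a n)%R) ->
  (forall n, (rsum a n <= M)%R) ->
  exists l, Cseq_lim u l.
Proof.
intros H B.
assert (Ha : forall k, (0 <= a k)%R)
  by (intros k; apply Rle_trans with (2 := H k), Cmod_ge_0).
assert (D : forall n m, (n <= m)%nat ->
  (Cmod (u m - u n) <= rsum a m - rsum a n)%R).
{ intros n m Hnm; induction Hnm as [|m Hnm IH].
  - replace (u n - u n) with (RtoC 0) by ring; rewrite Cmod_0; lra.
  - simpl; replace (u (S m) - u n) with ((u (S m) - u m) + (u m - u n)) by ring.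
    pose proof (Cmod_triangle (u (S m) - u m) (u m - u n)).
    specialize (H m); lra. }
assert (Cau : forall eps : R, (0 < eps)%R -> exists N, forall n m,
  (N <= n)%nat -> (N <= m)%nat -> (Cmod (u n - u m) < eps)%R).
{ intros eps Heps.
  destruct (rsum_cauchy a M Ha B (eps / 2)%R ltac:(lra)) as [N HN].
  exists N; intros n m Hn Hm.
  replace (u n - u m) with ((u n - u N) + - (u m - u N)) by ring.
  pose proof (Cmod_triangle (u n - u N) (- (u m - u N))) as T.
  rewrite Cmod_opp in T.
  pose proof (D N n Hn); pose proof (D N m Hm).
  pose proof (HN n Hn); pose proof (HN m Hm); lra. }
destruct (Rcomplete.R_complete (fun n => Re (u n))) as [l1 Hl1].
{ intros eps Heps; destruct (Cau eps Heps) as [N HN]; exists N.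
  intros n m Hn Hm; unfold Rdist.
  apply Rle_lt_trans with (2 := HN n m Hn Hm).
  apply (re_le_Cmod (u n - u m)). }
destruct (Rcomplete.R_complete (fun n => Im (u n))) as [l2 Hl2].
{ intros eps Heps; destruct (Cau eps Heps) as [N HN]; exists N.
  intros n m Hn Hm; unfold Rdist.
  apply Rle_lt_trans with (2 := HN n m Hn Hm).
  apply Rle_trans with (2 := Rmax_Cmod (u n - u m)), Rmax_r. }
exists (l1, l2); intros eps Heps.
destruct (Hl1 (eps / 2)%R ltac:(lra)) as [N1 HN1].
destruct (Hl2 (eps / 2)%R ltac:(lra)) as [N2 HN2].
exists (Nat.max N1 N2); intros n Hn.
specialize (HN1 n ltac:(lia)); specialize (HN2 n ltac:(lia)).
unfold Rdist in *.
replace (u n - (l1, l2)) with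
  (RtoC (Re (u n) - l1) + Ci * RtoC (Im (u n) - l2)).
2:{ destruct (u n) as [p q]; unfold Re, Im, Ci; simpl.
    apply injective_projections; simpl; ring. }
apply Rle_lt_trans with (1 := Cmod_triangle _ _).
rewrite Cmod_mult, Cmod_Ci, !Cmod_R; lra.
Qed.

(** * Infinite products with summable coefficients *)

Definition pprod (c : nat -> C) (w : C) : nat -> C :=
  Cprod (fun k => 1 + c k * w).

Definition iprod (c : nat -> C) (w : C) : C := Clim eventually (pprod c w).

(** Majorant of [pprod c w n] on the whole disc |w| <= r; it carries every uniform bound below. *)
Fixpoint mprod (c : nat -> C) (r : R) (n : nat) : R :=
  match n with O => 1%R | S m => (mprod c r m * (1 + Cmod (c m) * r))%R end.

Lemma mprod_ge1 (c : nat -> C) (r : R) (n : nat) :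
  (0 <= r)%R -> (1 <= mprod c r n)%R.
Proof.
intros Hr; induction n as [|n IH]; simpl; [lra |].
pose proof (Rmult_le_pos _ _ (Cmod_ge_0 (c n)) Hr); nra.
Qed.

Lemma mprod_le_exp (c : nat -> C) (r : R) (n : nat) : (0 <= r)%R ->
  (mprod c r n <= exp (r * rsum (fun k => Cmod (c k)) n))%R.
Proof.
intros Hr; induction n as [|n IH]; simpl.
- rewrite Rmult_0_r, exp_0; lra.
- rewrite (Rmult_plus_distr_l r), exp_plus.
  pose proof (mprod_ge1 c r n Hr); pose proof (Rmult_le_pos _ _ (Cmod_ge_0 (c n)) Hr).
  apply Rmult_le_compat; try lra.
  rewrite (Rmult_comm (Cmod _)); apply exp_ineq1_le.
Qed.

Lemma factor_le (a w : C) (r : R) : (Cmod w <= r)%R ->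
  (Cmod (1 + a * w) <= 1 + Cmod a * r)%R.
Proof.
intros H.
apply Rle_trans with (1 := Cmod_triangle _ _).
rewrite Cmod_1, Cmod_mult; pose proof (Cmod_ge_0 a); nra.
Qed.

Lemma pprod_le_mprod (c : nat -> C) (w : C) (r : R) (n : nat) :
  (Cmod w <= r)%R -> (Cmod (pprod c w n) <= mprod c r n)%R.
Proof.
intros Hw; induction n as [|n IH]; simpl.
- unfold pprod; simpl; rewrite Cmod_1; lra.
- unfold pprod; simpl; rewrite Cmod_mult.
  apply Rmult_le_compat; auto using Cmod_ge_0, factor_le.
Qed.

Lemma mprod_bounded (c : nat -> C) (r : R) : (0 <= r)%R -> summable c ->
  exists M, forall n, (mprod c r n <= M)%R.
Proof.
intros Hr [M HM]; exists (exp (r * M)); intros n.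
apply Rle_trans with (1 := mprod_le_exp c r n Hr).
apply exp_monotone; specialize (HM n); simpl in HM; nra.
Qed.

(** The n-th increment is P_n(w) w c_n, with P_n(w) below a bound A of the majorant, so the
    increments are dominated by A |w| |c_n|. *)
Lemma pprod_cv (c : nat -> C) (w : C) : summable c ->
  Cseq_lim (pprod c w) (iprod c w).
Proof.
intros Hc; destruct (mprod_bounded c (Cmod w) (Cmod_ge_0 w) Hc) as [A HA].
destruct Hc as [M HM].
assert (A1 : (1 <= A)%R)
  by (apply Rle_trans with (2 := HA 0%nat); simpl; lra).
destruct (Cseq_lim_of_increments (pprod c w)
  (fun k => (A * Cmod w * Cmod (c k))%R) (A * Cmod w * M)%R) as [l Hl].
- intros n; unfold pprod at 1; simpl; fold (pprod c w).
  fold (pprod c w n).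
  replace (pprod c w n * (1 + c n * w) - pprod c w n)
    with (pprod c w n * (w * c n)) by ring.
  rewrite !Cmod_mult, Rmult_assoc.
  apply Rmult_le_compat_r.
  + apply Rmult_le_pos; apply Cmod_ge_0.
  + apply Rle_trans with (2 := HA n), pprod_le_mprod; lra.
- intros n; rewrite rsum_scal; apply Rmult_le_compat_l; [| apply HM].
  pose proof (Cmod_ge_0 w); nra.
- unfold iprod; rewrite (Clim_seq_unique _ l Hl); exact Hl.
Qed.

Lemma iprod_unique (c : nat -> C) (w l : C) :
  Cseq_lim (pprod c w) l -> iprod c w = l.
Proof. apply Clim_seq_unique. Qed.

(** * Differentiability of the infinite product *)

(** The derivative of [pprod c w n] in w, given by the product rule. *)
Fixpoint dprod (c : nat -> C) (w : C) (n : nat) : C :=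
  match n with
  | O => 0
  | S m => dprod c w m * (1 + c m * w) + pprod c w m * c m
  end.

(** In each summand of the product rule one factor is replaced by c_k; the majorant of the missing
    factor is at least 1, so restoring it only enlarges the bound. *)
Lemma dprod_le (c : nat -> C) (w : C) (r : R) (n : nat) : (Cmod w <= r)%R ->
  (Cmod (dprod c w n) <= mprod c r n * rsum (fun k => Cmod (c k)) n)%R.
Proof.
intros Hw; pose proof (Cmod_ge_0 w) as Hw0.
induction n as [|n IH]; simpl.
- rewrite Cmod_0; lra.
- apply Rle_trans with (1 := Cmod_triangle _ _); rewrite !Cmod_mult.
  pose proof (factor_le (c n) w r Hw) as F.
  pose proof (pprod_le_mprod c w r n Hw) as P.
  pose proof (mprod_ge1 c r n ltac:(lra)).
  pose proof (Cmod_ge_0 (c n)).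
  pose proof (Cmod_ge_0 (dprod c w n)); pose proof (Cmod_ge_0 (1 + c n * w)).
  pose proof (rsum_ge0 (fun k => Cmod (c k)) n (fun k => Cmod_ge_0 _)).
  set (s := rsum _ _) in *; set (A := mprod _ _ _) in *.
  assert (Cmod (dprod c w n) * Cmod (1 + c n * w)
    <= A * s * (1 + Cmod (c n) * r))%R by (apply Rmult_le_compat; auto).
  assert (Cmod (pprod c w n) * Cmod (c n) <= A * Cmod (c n))%R
    by (apply Rmult_le_compat_r; auto).
  assert (0 <= A * (Cmod (c n) * r) * Cmod (c n))%R
    by (repeat apply Rmult_le_pos; lra).
  lra.
Qed.

(** Second-order remainder with a bound that becomes uniform in n once c is summable. Since |h| <=
    1, the radius |w| + 1 serves for both w and w + h. *)
Lemma pprod_taylor (c : nat -> C) (w h : C) (n : nat) : (Cmod h <= 1)%R ->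
  (Cmod (pprod c (w + h) n - pprod c w n - h * dprod c w n)
   <= (Cmod h)^2 * (mprod c (Cmod w + 1) n
        * (rsum (fun k => Cmod (c k)) n)^2))%R.
Proof.
intros Hh; set (r := (Cmod w + 1)%R).
pose proof (Cmod_ge_0 w) as Hw0.
assert (Hwh : (Cmod (w + h) <= r)%R)
  by (apply Rle_trans with (1 := Cmod_triangle _ _); unfold r; lra).
induction n as [|n IH].
- unfold pprod; simpl; replace (1 - 1 - h * 0) with (RtoC 0) by ring.
  rewrite Cmod_0; lra.
- unfold pprod; simpl dprod; simpl Cprod.
  fold (pprod c (w + h)) (pprod c w).
  fold (pprod c (w + h) n) (pprod c w n).
  (* Recursion for the remainder: R_(n+1) = R_n (1 + c_n (w + h)) + h^2 c_n D_n, where D_n is the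
     derivative. *)
  replace (_ - _ - _) with
    ((pprod c (w + h) n - pprod c w n - h * dprod c w n)
       * (1 + c n * (w + h)) + (h * h) * (c n * dprod c w n)) by ring.
  apply Rle_trans with (1 := Cmod_triangle _ _); rewrite !Cmod_mult.
  pose proof (factor_le (c n) (w + h) r Hwh) as F.
  pose proof (dprod_le c w r n ltac:(unfold r; lra)) as D.
  pose proof (mprod_ge1 c r n ltac:(unfold r; lra)).
  pose proof (Cmod_ge_0 (c n)) as Hc.
  pose proof (Cmod_ge_0 h) as Hh0.
  pose proof (rsum_ge0 (fun k => Cmod (c k)) n (fun k => Cmod_ge_0 _)).
  simpl mprod; simpl rsum.
  set (s := rsum _ _) in *; set (A := mprod _ _ _) in *.
  set (E := Cmod (_ - _)) in *.
  assert (E0 : (0 <= E)%R) by apply Cmod_ge_0.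
  pose proof (Cmod_ge_0 (1 + c n * (w + h))) as F0.
  set (q := Cmod (c n)) in *; set (f := Cmod (1 + _)) in *.
  set (d := Cmod (dprod _ _ _)) in *; set (t := Cmod h) in *.
  assert (E * f <= t ^ 2 * (A * s ^ 2) * (1 + q * r))%R
    by (apply Rmult_le_compat; auto).
  assert (0 <= t * t)%R by nra.
  assert (t * t * (q * d) <= t * t * (q * (A * s)))%R
    by (apply Rmult_le_compat_l; auto; apply Rmult_le_compat_l; auto).
  assert (r0 : (0 <= r)%R) by (unfold r; lra).
  assert (0 <= (t * t) * (A * (q * s)))%R
    by (repeat apply Rmult_le_pos; lra).
  assert (0 <= (t * t) * (A * (q * q)))%R
    by (repeat apply Rmult_le_pos; lra).
  assert (0 <= (t * t) * (A * (q * r) * (q * s)))%R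
    by (repeat apply Rmult_le_pos; lra).
  assert (0 <= (t * t) * (A * (q * r) * (q * q)))%R
    by (repeat apply Rmult_le_pos; lra).
  apply Rle_trans with
    (t ^ 2 * (A * s ^ 2) * (1 + q * r) + t * t * (q * (A * s)))%R; [lra |].
  (* After expansion of (s + q)^2 (1 + q r), the slack is a sum of products of nonnegative
     numbers. *)
  apply Rminus_le_0.
  replace (_ - _)%R with ((t * t) * (A * (q * s)) + (t * t) * (A * (q * q))
    + 2 * ((t * t) * (A * (q * r) * (q * s)))
    + (t * t) * (A * (q * r) * (q * q)))%R by ring.
  lra.
Qed.

Lemma dprod_cv (c : nat -> C) (w : C) : summable c ->
  exists d, Cseq_lim (dprod c w) d.
Proof.
intros Hc; destruct (mprod_bounded c (Cmod w) (Cmod_ge_0 w) Hc) as [A HA].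
destruct Hc as [M HM].
assert (A1 : (1 <= A)%R)
  by (apply Rle_trans with (2 := HA 0%nat); simpl; lra).
assert (M0 : (0 <= M)%R) by apply (HM 0%nat).
pose proof (Cmod_ge_0 w) as W0.
apply (Cseq_lim_of_increments (dprod c w)
  (fun k => ((A * M * Cmod w + A) * Cmod (c k))%R)
  ((A * M * Cmod w + A) * M)%R).
- intros n; simpl.
  replace (dprod c w n * (1 + c n * w) + pprod c w n * c n - dprod c w n)
    with ((dprod c w n * w + pprod c w n) * c n) by ring.
  rewrite Cmod_mult; apply Rmult_le_compat_r; [apply Cmod_ge_0 |].
  apply Rle_trans with (1 := Cmod_triangle _ _); rewrite Cmod_mult.
  pose proof (dprod_le c w (Cmod w) n (Rle_refl _)) as D.
  pose proof (pprod_le_mprod c w (Cmod w) n (Rle_refl _)) as P.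
  specialize (HA n); specialize (HM n).
  pose proof (rsum_ge0 (fun k => Cmod (c k)) n (fun k => Cmod_ge_0 _)).
  pose proof (mprod_ge1 c (Cmod w) n W0).
  assert (mprod c (Cmod w) n * rsum (fun k => Cmod (c k)) n <= A * M)%R
    by (apply Rmult_le_compat; lra).
  assert (Cmod (dprod c w n) * Cmod w <= A * M * Cmod w)%R
    by (apply Rmult_le_compat_r; lra).
  lra.
- intros n; rewrite rsum_scal; apply Rmult_le_compat_l; [| apply HM].
  assert (0 <= A * M * Cmod w)%R by (repeat apply Rmult_le_pos; lra).
  lra.
Qed.

Lemma Cseq_lim_plus (u v : nat -> C) (l m : C) :
  Cseq_lim u l -> Cseq_lim v m -> Cseq_lim (fun n => u n + v n) (l + m).
Proof.
intros Hu Hv eps Heps.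
destruct (Hu (eps / 2)%R ltac:(lra)) as [N1 H1].
destruct (Hv (eps / 2)%R ltac:(lra)) as [N2 H2].
exists (Nat.max N1 N2); intros n Hn.
specialize (H1 n ltac:(lia)); specialize (H2 n ltac:(lia)).
replace (u n + v n - (l + m)) with ((u n - l) + (v n - m)) by ring.
apply Rle_lt_trans with (1 := Cmod_triangle _ _); lra.
Qed.

(* The quadratic remainder bound holds for the partial products uniformly in
   n, hence for the limit: this replaces the Weierstrass convergence theorem. *)
Lemma iprod_ex_derive (c : nat -> C) (w : C) : summable c ->
  ex_derive (K := C_AbsRing) (V := C_NormedModule) (iprod c) w.
Proof.
intros Hc; destruct (dprod_cv c w Hc) as [d Hd].
pose proof (Cmod_ge_0 w) as W0.
destruct (mprod_bounded c (Cmod w + 1) ltac:(lra) Hc) as [A HA].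
assert (A1 : (1 <= A)%R)
  by (apply Rle_trans with (2 := HA 0%nat); simpl; lra).
pose proof Hc as [M HM].
assert (M0 : (0 <= M)%R) by apply (HM 0%nat).
assert (T : forall h : C, (Cmod h <= 1)%R ->
  (Cmod (iprod c (w + h) - iprod c w - h * d)
   <= (Cmod h)^2 * (A * M^2))%R).
{ intros h Hh.
  (* The remainder is written with sums and scalar multiples only, so that the limit rules apply to
     it term by term. *)
  apply (Cseq_lim_Cmod_le
    (fun n => pprod c (w + h) n + (- (1)) * pprod c w n + (- h) * dprod c w n)
    _ _ 0).
  - intros n _.
    replace (_ + _ + _) with
      (pprod c (w + h) n - pprod c w n - h * dprod c w n) by ring.
    apply Rle_trans with (1 := pprod_taylor c w h n Hh).
    apply Rmult_le_compat_l; [apply pow2_ge_0 |].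
    pose proof (mprod_ge1 c (Cmod w + 1) n ltac:(lra)).
    pose proof (rsum_ge0 (fun k => Cmod (c k)) n (fun k => Cmod_ge_0 _)).
    apply Rmult_le_compat; [lra | apply pow2_ge_0 | apply HA |].
    apply pow_incr; split; [lra | apply HM].
  - replace (iprod c (w + h) - iprod c w - h * d) with
      (iprod c (w + h) + (- (1)) * iprod c w + (- h) * d) by ring.
    repeat apply Cseq_lim_plus; try apply Cseq_lim_scal;
      auto using pprod_cv. }
assert (T' : forall y : C, (Cmod (y - w) <= 1)%R ->
  (Cmod (iprod c y - iprod c w - (y - w) * d)
   <= (Cmod (y - w))^2 * (A * M^2))%R).
{ intros y Hy; specialize (T (y - w) Hy).
  now replace (w + (y - w)) with y in T by ring. }
exists d; split.
- apply (is_linear_scal_l (K := C_AbsRing) (V := C_NormedModule)).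
- intros x Hx.
  assert (w = x) as <-
    by exact (is_filter_lim_locally_unique
      (V := AbsRing_NormedModule C_AbsRing) _ _ Hx).
  intros eps.
  set (K := (A * M ^ 2)%R) in *.
  assert (K0 : (0 <= K)%R).
  { apply Rmult_le_pos; [lra | apply pow2_ge_0]. }
  pose proof (cond_pos eps) as E0.
  (* The bound 1 keeps y - w in the range of [T']; K + 1 instead of K avoids division by zero. *)
  assert (De : (0 < Rmin 1 (eps / (K + 1)))%R).
  { apply Rmin_glb_lt; [lra | apply Rdiv_lt_0_compat; lra]. }
  exists (mkposreal _ De); intros y Hy.
  change (Cmod (y - w) < Rmin 1 (eps / (K + 1)))%R in Hy.
  change (Cmod (iprod c y - iprod c w - (y - w) * d) <= eps * Cmod (y - w))%R.
  pose proof (Rmin_l 1 (eps / (K + 1))).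
  pose proof (Rmin_r 1 (eps / (K + 1))) as R2.
  apply Rle_trans with (1 := T' y ltac:(lra)).
  pose proof (Cmod_ge_0 (y - w)).
  replace (Cmod (y - w) ^ 2 * K)%R with ((K * Cmod (y - w)) * Cmod (y - w))%R
    by ring.
  apply Rmult_le_compat_r; [easy |].
  apply Rle_trans with ((K + 1) * (eps / (K + 1)))%R.
  + apply Rmult_le_compat; lra.
  + right; field; lra.
Qed.

(** * Nonvanishing of the infinite product *)

(** Weierstrass inequality, prod (1 - x_k) >= 1 - sum x_k with x_k = |w| |c_k|, for the factors from
    index N on. The smallness hypothesis keeps the lower bound nonnegative throughout the
    induction. *)
Lemma pprod_tail_ge (c : nat -> C) (w : C) (N n : nat) : (N <= n)%nat ->
  (Cmod w * (rsum (fun k => Cmod (c k)) n - rsum (fun k => Cmod (c k)) N)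
     <= 1)%R ->
  (Cmod (pprod c w N) * (1 - Cmod w *
     (rsum (fun k => Cmod (c k)) n - rsum (fun k => Cmod (c k)) N))
   <= Cmod (pprod c w n))%R.
Proof.
intros Hn; induction Hn as [|n Hn IH]; intros Hs.
- rewrite Rminus_diag, Rmult_0_r; lra.
- unfold pprod; simpl; fold (pprod c w N) (pprod c w n); simpl in Hs.
  pose proof (Cmod_ge_0 (c n)); pose proof (Cmod_ge_0 w).
  pose proof (rsum_incr (fun k => Cmod (c k)) N n (fun k => Cmod_ge_0 _) Hn).
  set (s := rsum _ n) in *; set (s0 := rsum _ N) in *.
  rewrite Cmod_mult.
  assert (F : (1 - Cmod w * Cmod (c n) <= Cmod (1 + c n * w))%R).
  { pose proof (Cmod_triangle_inv 1 (- (c n * w))) as T.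
    rewrite Cmod_opp, Cmod_mult, Cmod_1 in T.
    replace (1 - - (c n * w)) with (1 + c n * w) in T by ring; lra. }
  assert (0 <= Cmod w * Cmod (c n))%R by nra.
  assert (0 <= Cmod w * (s - s0))%R by nra.
  specialize (IH ltac:(nra)).
  pose proof (Cmod_ge_0 (pprod c w N)).
  apply Rle_trans with
    ((Cmod (pprod c w N) * (1 - Cmod w * (s - s0)))
      * (1 - Cmod w * Cmod (c n)))%R.
  + rewrite Rmult_assoc; apply Rmult_le_compat_l; [easy |].
    assert (0 <= (Cmod w * (s - s0)) * (Cmod w * Cmod (c n)))%R
      by (apply Rmult_le_pos; lra).
    lra.
  + apply Rmult_le_compat; try lra; try nra.
Qed.

Lemma pprod_neq0 (c : nat -> C) (w : C) (n : nat) :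
  (forall k, 1 + c k * w <> 0) -> pprod c w n <> 0.
Proof.
intros H; induction n as [|n IH].
- apply C1_nz.
- apply Cmult_neq_0; auto.
Qed.

(** Past an index N where |w| times the remaining sum is at most 1/2, the modulus stays above half
    of that of the N-th partial product, which is nonzero. *)
Lemma iprod_neq0 (c : nat -> C) (w : C) : summable c ->
  (forall k, 1 + c k * w <> 0) -> iprod c w <> 0.
Proof.
intros Hc H.
pose proof (pprod_cv c w Hc) as L.
pose proof (Cmod_ge_0 w) as W0.
destruct Hc as [M HM].
destruct (rsum_cauchy _ M (fun k => Cmod_ge_0 _) HM (/ (2 * (Cmod w + 1)))%R)
  as [N HN].
{ apply Rinv_0_lt_compat; lra. }
assert (P : (0 < Cmod (pprod c w N))%R)
  by (apply Cmod_gt_0, pprod_neq0, H).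
apply Cmod_gt_0, Rlt_le_trans with (Cmod (pprod c w N) / 2)%R; [lra |].
apply (Cseq_lim_Cmod_ge (pprod c w) _ _ N); [| exact L].
intros n Hn; specialize (HN n Hn); simpl in HN.
pose proof (rsum_incr (fun k => Cmod (c k)) N n (fun k => Cmod_ge_0 _) Hn).
set (s := rsum _ n) in *; set (s0 := rsum _ N) in *.
assert (Hs : (Cmod w * (s - s0) <= / 2)%R).
{ apply Rle_trans with ((Cmod w + 1) * / (2 * (Cmod w + 1)))%R.
  - apply Rmult_le_compat; lra.
  - right; field; lra. }
pose proof (pprod_tail_ge c w N n Hn) as T.
fold s s0 in T; specialize (T ltac:(lra)).
apply Rle_trans with (2 := T); unfold Rdiv.
apply Rmult_le_compat_l; lra.
Qed.

(** * Splitting off finitely many factors *)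

(** A zero coefficient turns the factor into 1, so that no index is shifted. *)
Definition drop (c : nat -> C) (j : nat) : nat -> C :=
  fun k => if Nat.eq_dec k j then 0 else c k.

Lemma summable_drop (c : nat -> C) (j : nat) : summable c -> summable (drop c j).
Proof.
intros [M HM]; exists M; intros n; apply Rle_trans with (2 := HM n).
apply rsum_le; intros k; unfold drop.
destruct (Nat.eq_dec k j); [rewrite Cmod_0; apply Cmod_ge_0 | lra].
Qed.

(** Partial products agree up to index j and afterwards differ by exactly the removed factor; this
    relation passes to the limit. *)
Lemma iprod_drop (c : nat -> C) (w : C) (j : nat) : summable c ->
  iprod c w = (1 + c j * w) * iprod (drop c j) w.
Proof.
intros Hc; apply iprod_unique.
assert (E1 : forall n, (n <= j)%nat -> pprod (drop c j) w n = pprod c w n).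
{ intros n; induction n as [|n IH]; intros Hn; [easy |].
  unfold pprod; simpl; fold (pprod c w n) (pprod (drop c j) w n).
  rewrite IH by lia; unfold drop; destruct (Nat.eq_dec n j); [lia | easy]. }
assert (E2 : forall n, (S j <= n)%nat ->
  (1 + c j * w) * pprod (drop c j) w n = pprod c w n).
{ intros n Hn; induction Hn as [|n Hn IH].
  - unfold pprod; simpl; fold (pprod c w j) (pprod (drop c j) w j).
    rewrite E1 by lia; unfold drop; destruct (Nat.eq_dec j j); [ring | easy].
  - unfold pprod; simpl; fold (pprod c w n) (pprod (drop c j) w n).
    rewrite <- IH; unfold drop; destruct (Nat.eq_dec n j); [lia | ring]. }
apply (Cseq_lim_eventually_eq _ _ _ _ E2), Cseq_lim_scal, pprod_cv.
now apply summable_drop.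
Qed.

Fixpoint drops (c : nat -> C) (l : list nat) : nat -> C :=
  match l with nil => c | cons j l' => drops (drop c j) l' end.

(** The alternative [c k = 0] makes the induction go through: a coefficient already removed must
    stay zero. *)
Lemma drops_in (c : nat -> C) (l : list nat) (k : nat) :
  (In k l \/ c k = 0) -> drops c l k = 0.
Proof.
revert c; induction l as [|j l IH]; simpl; intros c H.
- now destruct H.
- apply IH; unfold drop; destruct (Nat.eq_dec k j); [now right |].
  destruct H as [[-> | H] | H]; [easy | now left | now right].
Qed.

Lemma drops_notin (c : nat -> C) (l : list nat) (k : nat) :
  ~ In k l -> drops c l k = c k.
Proof.
revert c; induction l as [|j l IH]; simpl; intros c H; [easy |].
rewrite IH by tauto; unfold drop.
destruct (Nat.eq_dec k j); [intuition congruence | easy].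
Qed.

Lemma summable_drops (c : nat -> C) (l : list nat) :
  summable c -> summable (drops c l).
Proof.
revert c; induction l as [|j l IH]; simpl; intros c H; [easy |].
now apply IH, summable_drop.
Qed.

(** Induction on the list: by [NoDup], dropping its head leaves the coefficients at the other listed
    indices equal to a. *)
Lemma iprod_drops (c : nat -> C) (a w : C) (l : list nat) : summable c ->
  NoDup l -> (forall j, In j l -> c j = a) ->
  iprod c w = (1 + a * w) ^ (length l) * iprod (drops c l) w.
Proof.
revert c; induction l as [|j l IH]; simpl; intros c Hc Hl H.
- ring.
- inversion Hl as [|j' l' Hj Hl']; subst.
  rewrite (iprod_drop c w j Hc), (IH (drop c j)).
  + rewrite (H j) by tauto; ring.
  + now apply summable_drop.
  + easy.
  + intros k Hk; unfold drop; destruct (Nat.eq_dec k j) as [-> |]; [easy |].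
    apply H; tauto.
Qed.

(** * The asymptotic expansion on the positive real axis *)

Lemma Cseq_lim_Re (u : nat -> C) (l : C) :
  Cseq_lim u l -> Un_cv (fun n => Re (u n)) (Re l).
Proof.
intros H eps Heps; destruct (H eps Heps) as [N HN].
exists N; intros n Hn; unfold Rdist.
apply Rle_lt_trans with (2 := HN n Hn), (re_le_Cmod (u n - l)).
Qed.

Lemma Re_Csum (u : nat -> C) (n : nat) :
  Re (Csum u n) = rsum (fun k => Re (u k)) (S n).
Proof.
unfold Csum; induction n as [|n IH].
- rewrite sum_O; simpl; ring.
- rewrite sum_Sn; simpl rsum; simpl in IH; rewrite <- IH; reflexivity.
Qed.

Lemma Un_cv_rsum_le (a : nat -> R) (l : R) : (forall k, (0 <= a k)%R) ->
  Un_cv (rsum a) l -> forall n, (rsum a n <= l)%R.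
Proof.
intros Ha H n; apply growing_ineq; [| easy].
intros k; simpl; specialize (Ha k); lra.
Qed.

Lemma Un_cv_of_succ (u : nat -> R) (l : R) :
  Un_cv (fun n => u (S n)) l -> Un_cv u l.
Proof.
intros H eps Heps; destruct (H eps Heps) as [N HN].
exists (S N); intros [|n] Hn; [lia |]; apply HN; lia.
Qed.

Lemma Carg_pos (x : R) : (0 < x)%R -> Carg (RtoC x) = 0%R.
Proof.
intros Hx; unfold Carg; simpl.
destruct (Rle_dec 0 0) as [_ | []]; [| lra].
rewrite Cmod_R, Rabs_pos_eq by lra.
unfold Rdiv; rewrite Rinv_r by lra; apply acos_1.
Qed.

Lemma Cinfty_filter : Filter Cinfty.
Proof.
constructor.
- now exists 0%R.
- intros P Q [M1 H1] [M2 H2]; exists (Rmax M1 M2); intros z Hz.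
  split; [apply H1 | apply H2].
  + apply Rle_lt_trans with (2 := Hz), Rmax_l.
  + apply Rle_lt_trans with (2 := Hz), Rmax_r.
- intros P Q H [M HM]; exists M; auto.
Qed.

(** Positive reals have argument 0 and so lie in every sector; the expansion at order 0, where a_0 =
    0, then bounds the real part of the difference. *)
Lemma riemann_real_axis (alpha : nat -> C) : riemann_expansion alpha ->
  exists (x0 : R) (s : R -> R), (1 <= x0)%R /\ forall x : R, (x0 <= x)%R ->
    Un_cv (rsum (fun k => Re (2 * x / (x ^ 2 + alpha k ^ 2)))) (s x) /\
    (Rabs (s x - 1 / 2 * ln (x / (2 * PI))) < 2)%R.
Proof.
intros [E [B [_ [_ [a [F [HS HA]]]]]]].
pose proof PI_RGT_0 as P0.
specialize (HA 0%nat (PI / 4)%R ltac:(lra)).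
destruct (proj1 (@filterlim_locally _ C_UniformSpace _
  (within_filter _ _ _ Cinfty_filter) _ _) HA (mkposreal 1 Rlt_0_1)) as [M HM].
(* The three lower bounds ensure positivity, convergence of the series, and validity of the
   asymptotic estimate. *)
exists (Rmax 1 (Rmax (a + 1) (M + 1)))%R, (fun x => Re (F (RtoC x))).
split; [apply Rmax_l |]; intros x Hx.
pose proof (Rmax_l 1 (Rmax (a + 1) (M + 1))).
pose proof (Rmax_r 1 (Rmax (a + 1) (M + 1))).
pose proof (Rmax_l (a + 1) (M + 1)).
pose proof (Rmax_r (a + 1) (M + 1)).
split.
- specialize (HS (RtoC x) ltac:(simpl; lra)).
  apply Cseq_limE, Cseq_lim_Re in HS.
  apply Un_cv_of_succ; intros eps Heps; destruct (HS eps Heps) as [N HN].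
  exists N; intros n Hn; specialize (HN n Hn).
  rewrite Re_Csum in HN; exact HN.
- assert (Hx0 : (0 < x)%R) by lra.
  specialize (HM (RtoC x)).
  rewrite Cmod_R, Carg_pos, Rabs_R0, Rabs_pos_eq in HM by lra.
  specialize (HM ltac:(lra) ltac:(lra)).
  (* A ball of radius 1 only gives modulus below sqrt 2, whence the constant 2 in the statement. *)
  apply (C_NormedModule_mixin_compat2 (RtoC 0) _ (mkposreal 1 Rlt_0_1)) in HM.
  simpl pos in HM; rewrite Rmult_1_r in HM.
  assert (Q : (sqrt 2 < 2)%R).
  { rewrite <- (sqrt_square 2) at 2 by lra; apply sqrt_lt_1; lra. }
  apply Rlt_trans with (2 := Q), Rle_lt_trans with (2 := HM).
  apply Rle_trans with (2 := re_le_Cmod _); right; f_equal.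
  unfold Csum; rewrite sum_O.
  assert (E1 : RtoC x / (2 * PI) = RtoC (x / (2 * PI)))
    by (rewrite RtoC_div, RtoC_mult; [easy | nra]).
  unfold Clog; rewrite E1, Cmod_R, Rabs_pos_eq
    by (apply Rlt_le, Rdiv_lt_0_compat; nra).
  unfold minus, plus, opp; simpl; unfold Re; field.
Qed.

(** * Estimates for a single term and a single factor *)

Lemma Re_inv (w : C) : Re (/ w) = (Re w / Cmod w ^ 2)%R.
Proof. rewrite Cmod2_alt; destruct w as [p q]; reflexivity. Qed.

(** Put m = |w|. As Re w >= 1, it suffices that exp ((1 - m^(-2)) / 2) <= m, and this is 1 + u <=
    exp u at u = m^(-2) - 1. *)
Lemma exp_half_le_Cmod (w : C) : (1 <= Re w)%R ->
  (exp (1 / 2 * Re (1 - / w)) <= Cmod w)%R.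
Proof.
intros Hw; set (m := Cmod w).
assert (Hm : (1 <= m)%R).
{ apply Rle_trans with (2 := re_le_Cmod w).
  apply Rle_trans with (1 := Hw), Rle_abs. }
change (Re (1 - / w)) with (1 + - Re (/ w))%R.
rewrite Re_inv; fold m.
assert (H1 : (/ m ^ 2 <= Re w / m ^ 2)%R).
{ unfold Rdiv; rewrite <- (Rmult_1_l (/ m ^ 2)) at 1.
  apply Rmult_le_compat_r; [left; apply Rinv_0_lt_compat; nra | easy]. }
apply Rle_trans with (exp (1 / 2 * (1 - / m ^ 2))).
{ apply exp_monotone; lra. }
set (e := exp _).
assert (E0 : (0 < e)%R) by apply exp_pos.
assert (E1 : (e * e * exp (/ m ^ 2 - 1) = 1)%R).
{ unfold e; rewrite <- !exp_plus; transitivity (exp 0); [f_equal; lra | apply exp_0]. }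
clearbody e; pose proof (exp_ineq1_le (/ m ^ 2 - 1)) as E2.
assert (E3 : (e * e * / m ^ 2 <= 1)%R).
{ rewrite <- E1; apply Rmult_le_compat_l; [apply Rmult_le_pos |]; lra. }
apply (Rmult_le_compat_r (m ^ 2)) in E3; [| nra].
rewrite Rmult_assoc, Rinv_l in E3 by nra.
nra.
Qed.

Lemma Re_sqr (a : C) : Re (a ^ 2) = (Re a ^ 2 - Im a ^ 2)%R.
Proof. destruct a as [u v]; unfold Re, Im; simpl; ring. Qed.

Lemma Re_RtoC_mult (t : R) (w : C) : Re (RtoC t * w) = (t * Re w)%R.
Proof. destruct w as [p q]; simpl; ring. Qed.

Lemma Re_RtoC_div (t : R) (w : C) : Re (RtoC t / w) = (t * Re (/ w))%R.
Proof. apply Re_RtoC_mult. Qed.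

Definition xi_c (alpha : nat -> C) (k : nat) : C := - / (alpha k ^ 2).

Lemma Cmod_xi_c (alpha : nat -> C) (k : nat) : alpha k <> 0 ->
  Cmod (xi_c alpha k) = (/ Cmod (alpha k) ^ 2)%R.
Proof.
intros H; unfold xi_c; rewrite Cmod_opp, Cmod_inv, Cmod_pow; [easy |].
now apply Cpow_nz.
Qed.

(** Put q = |a|^2 and w = x^2 + a^2. Since (Im a)^2 is at most (Re a)^2 and at most x^2, Re w >=
    (x^2 + q)/4, while |w| <= x^2 + q; hence Re (1/w) = Re w / |w|^2 >= 1 / (4 (x^2 + q)). *)
Lemma Re_term_ge (a : C) (x : R) : (0 < x)%R ->
  (Rabs (Im a) < Re a)%R -> (Rabs (Im a) <= x)%R ->
  (1 / 4 * (2 * x * / Cmod a ^ 2 / (1 + / Cmod a ^ 2 * x ^ 2))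
    <= Re (2 * x / (x ^ 2 + a ^ 2)))%R.
Proof.
intros Hx H1 H2.
assert (Hu : (0 < Re a)%R) by (pose proof (Rabs_pos (Im a)); lra).
assert (V1 : (Im a ^ 2 <= Re a ^ 2)%R)
  by (rewrite <- (pow2_abs (Im a)); apply pow_incr; split; [apply Rabs_pos | lra]).
assert (V2 : (Im a ^ 2 <= x ^ 2)%R)
  by (rewrite <- (pow2_abs (Im a)); apply pow_incr; split; [apply Rabs_pos | lra]).
replace (2 * RtoC x) with (RtoC (2 * x)) by apply RtoC_mult.
rewrite Re_RtoC_div, Re_inv.
set (q := (Cmod a ^ 2)%R).
assert (Hq : q = (Re a ^ 2 + Im a ^ 2)%R) by apply Cmod2_alt.
assert (Hq0 : (0 < q)%R) by nra.
assert (HR : Re (x ^ 2 + a ^ 2) = (x ^ 2 + (Re a ^ 2 - Im a ^ 2))%R).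
{ rewrite <- Re_sqr, <- RtoC_pow; reflexivity. }
set (w := (x ^ 2 + a ^ 2)) in *.
assert (Hw : (Cmod w <= x ^ 2 + q)%R).
{ apply Rle_trans with (1 := Cmod_triangle _ _).
  rewrite <- RtoC_pow, Cmod_R, Cmod_pow, Rabs_pos_eq by nra.
  fold q; lra. }
assert (Hw0 : (0 < Cmod w)%R).
{ apply Rlt_le_trans with (Rabs (Re w)); [| apply re_le_Cmod].
  rewrite HR; apply Rlt_le_trans with (2 := Rle_abs _); nra. }
assert (Hw2 : (Cmod w ^ 2 <= (x ^ 2 + q) ^ 2)%R) by (apply pow_incr; lra).
replace (1 / 4 * (2 * x * / q / (1 + / q * x ^ 2)))%R
  with (2 * x * ((x ^ 2 + q) / 4 * / (x ^ 2 + q) ^ 2))%R by (field; nra).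
apply Rmult_le_compat_l; [lra |].
unfold Rdiv at 2; apply Rmult_le_compat.
- nra.
- left; apply Rinv_0_lt_compat; nra.
- rewrite HR, Hq; nra.
- apply Rinv_le_contravar; nra.
Qed.

(** Apply [exp_half_le_Cmod] to w = 1 + y^2/a^2, for which 1 - 1/w = y^2/(y^2 + a^2). Its real part
    is at least 1 because Re (a^2) > 0. *)
Lemma factor_exp_le (a : C) (y : R) : (0 < y)%R -> (Rabs (Im a) < Re a)%R ->
  (exp (y / 4 * Re (2 * y / (y ^ 2 + a ^ 2))) <= Cmod (1 + y ^ 2 / a ^ 2))%R.
Proof.
intros Hy H1.
assert (Hu : (0 < Re a)%R) by (pose proof (Rabs_pos (Im a)); lra).
assert (V1 : (Im a ^ 2 < Re a ^ 2)%R).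
{ rewrite <- (pow2_abs (Im a)); pose proof (Rabs_pos (Im a)); nra. }
assert (A2 : a ^ 2 <> 0).
{ intros E; apply (f_equal Re) in E; rewrite Re_sqr in E; simpl in E; lra. }
assert (W2 : y ^ 2 + a ^ 2 <> 0).
{ intros E; apply (f_equal Re) in E; rewrite <- RtoC_pow in E.
  change (y ^ 2 + Re (a ^ 2) = 0)%R in E; rewrite Re_sqr in E; nra. }
replace (y / 4 * Re (2 * y / (y ^ 2 + a ^ 2)))%R
  with (1 / 2 * Re (1 - / (1 + y ^ 2 / a ^ 2)))%R.
- apply exp_half_le_Cmod.
  unfold Cdiv; change (Re (1 + y ^ 2 * / a ^ 2))%R
    with (1 + Re (y ^ 2 / a ^ 2))%R.
  rewrite <- RtoC_pow, Re_RtoC_div, Re_inv, Re_sqr.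
  assert (0 < Cmod (a ^ 2))%R by now apply Cmod_gt_0.
  assert (0 <= (Re a ^ 2 - Im a ^ 2) / Cmod (a ^ 2) ^ 2)%R.
  { apply Rlt_le, Rdiv_lt_0_compat; nra. }
  nra.
- replace (1 - / (1 + y ^ 2 / a ^ 2)) with
    (RtoC (y / 2) * (2 * y / (y ^ 2 + a ^ 2))).
  + rewrite Re_RtoC_mult. field.
  + rewrite RtoC_div by lra; field; repeat split; auto.
    * intros ->; apply A2; ring.
    * intros E; apply W2; rewrite <- E; ring.
Qed.

(** * Bounds and summability for a Riemann sequence *)

Lemma riemann_Re_gt1 (alpha : nat -> C) (k : nat) :
  riemann_sequence alpha -> (1 < Re (alpha k))%R.
Proof.
intros H; induction k as [|k IH]; [apply riemann_gt1, H |].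
apply Rlt_le_trans with (1 := IH), riemann_mono, H.
Qed.

Lemma riemann_neq0 (alpha : nat -> C) (k : nat) :
  riemann_sequence alpha -> alpha k <> 0.
Proof.
intros H E; pose proof (riemann_Re_gt1 alpha k H) as H1.
rewrite E in H1; simpl in H1; lra.
Qed.

Lemma riemann_Cmod_gt1 (alpha : nat -> C) (k : nat) :
  riemann_sequence alpha -> (1 < Cmod (alpha k))%R.
Proof.
intros H; apply Rlt_le_trans with (1 := riemann_Re_gt1 alpha k H).
apply Rle_trans with (1 := Rle_abs _), re_le_Cmod.
Qed.

(** The two forms in which condition (e) is used. The first bounds, uniformly in n, the derivative
    of the logarithm of the majorant; the second bounds the product at t = ix from below. *)
Lemma riemann_bounds (alpha : nat -> C) : riemann_sequence alpha ->
  exists x0 : R, (1 <= x0)%R /\ forall x : R, (x0 <= x)%R ->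
    (forall n, (rsum (fun k =>
       2 * x * Cmod (xi_c alpha k) / (1 + Cmod (xi_c alpha k) * x ^ 2)) n
       <= 2 * ln x + 8)%R) /\
    (forall l : C, Cseq_lim (Cprod (fun k => 1 + x ^ 2 / alpha k ^ 2)) l ->
       (exp (x / 4 * (1 / 2 * ln (x / (2 * PI)) - 2)) <= Cmod l)%R).
Proof.
intros H.
destruct (riemann_real_axis alpha (riemann_asymptotic alpha H))
  as [x1 [s [Hx1 Hs]]].
destruct (riemann_Im_bounded alpha H) as [M HM].
(* Taking x >= M gives |Im alpha_k| <= x, as [Re_term_ge] requires. *)
exists (Rmax x1 M); split; [apply Rle_trans with (2 := Rmax_l _ _), Hx1 |].
intros x Hx.
pose proof (Rmax_l x1 M); pose proof (Rmax_r x1 M).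
destruct (Hs x ltac:(lra)) as [L B]; apply Rabs_def2 in B.
assert (T : forall k, (1 / 4 * (2 * x * Cmod (xi_c alpha k)
    / (1 + Cmod (xi_c alpha k) * x ^ 2))
  <= Re (2 * x / (x ^ 2 + alpha k ^ 2)))%R).
{ intros k; rewrite Cmod_xi_c by now apply riemann_neq0.
  apply Re_term_ge; [lra | now apply riemann_arg |].
  specialize (HM k); lra. }
assert (T0 : forall k, (0 <= Re (2 * x / (x ^ 2 + alpha k ^ 2)))%R).
{ intros k; apply Rle_trans with (2 := T k).
  pose proof (Cmod_ge_0 (xi_c alpha k)).
  apply Rmult_le_pos; [lra |]; unfold Rdiv; apply Rmult_le_pos; [nra |].
  left; apply Rinv_0_lt_compat; nra. }
pose proof PI2_1 as P1.
split.
(* The bound is 4 ((1/2) ln x + 2), the 4 undoing the factor 1/4 of [T]. *)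
- intros n; pose proof (Un_cv_rsum_le _ _ T0 L n) as U.
  assert (V : (ln (x / (2 * PI)) <= ln x)%R).
  { apply ln_le; [apply Rdiv_lt_0_compat; lra |].
    apply Rmult_le_reg_r with (2 * PI)%R; [lra |].
    unfold Rdiv; rewrite Rmult_assoc, Rinv_l by lra; nra. }
  pose proof (rsum_le _ _ n T) as W; rewrite rsum_scal in W; lra.
- intros l Hl.
  apply Rnot_lt_le; intros Hlt.
  assert (P : forall n, (exp (x / 4 * rsum (fun k =>
      Re (2 * x / (x ^ 2 + alpha k ^ 2))) n)
    <= Cmod (Cprod (fun k => 1 + x ^ 2 / alpha k ^ 2)%C n))%R).
  { intros n; induction n as [|n IH]; simpl rsum; simpl Cprod.
    - rewrite Rmult_0_r, exp_0, Cmod_1; lra.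
    - rewrite Rmult_plus_distr_l, exp_plus, Cmod_mult.
      apply Rmult_le_compat; try apply Rlt_le, exp_pos; [apply IH |].
      apply factor_exp_le; [lra | now apply riemann_arg]. }
  set (g := (1 / 2 * ln (x / (2 * PI)) - 2)%R) in *.
  (* The sum s x lies strictly above g, so the partial sums eventually exceed g. *)
  destruct (L (s x - g)%R ltac:(unfold g; lra)) as [N HN].
  apply Rlt_not_le with (1 := Hlt).
  apply (Cseq_lim_Cmod_ge _ l _ N) with (2 := Hl); intros n Hn.
  specialize (HN n Hn); unfold Rdist in HN; apply Rabs_def2 in HN.
  apply Rle_trans with (2 := P n), exp_monotone, Rmult_le_compat_l; lra.
Qed.

(** One point x is enough: |c_k| <= 1 gives |c_k| <= (1 + x^2) |c_k| / (1 + |c_k| x^2), and the sums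
    of the right-hand side are bounded. *)
Lemma riemann_summable (alpha : nat -> C) :
  riemann_sequence alpha -> summable (xi_c alpha).
Proof.
intros H; destruct (riemann_bounds alpha H) as [x [Hx B]].
destruct (B x (Rle_refl x)) as [B1 _].
exists ((1 + x ^ 2) / (2 * x) * (2 * ln x + 8))%R; intros n.
assert (K : (0 <= (1 + x ^ 2) / (2 * x))%R)
  by (apply Rlt_le, Rdiv_lt_0_compat; nra).
apply Rle_trans with (2 := Rmult_le_compat_l _ _ _ K (B1 n)).
rewrite <- rsum_scal; apply rsum_le; intros k. cbv beta.
pose proof (riemann_Cmod_gt1 alpha k H) as G.
assert (Q : (0 < Cmod (xi_c alpha k) <= 1)%R).
{ rewrite Cmod_xi_c by now apply riemann_neq0.
  split; [apply Rinv_0_lt_compat; nra |].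
  rewrite <- Rinv_1; apply Rinv_le_contravar; nra. }
set (b := Cmod (xi_c alpha k)) in *.
replace ((1 + x ^ 2) / (2 * x) * (2 * x * b / (1 + b * x ^ 2)))%R
  with (b * ((1 + x ^ 2) * / (1 + b * x ^ 2)))%R by (field; nra).
apply Rle_trans with (b * 1)%R; [lra |]; apply Rmult_le_compat_l; [lra |].
apply Rmult_le_reg_r with (1 + b * x ^ 2)%R; [nra |].
rewrite Rmult_assoc, Rinv_l by nra; nra.
Qed.

(** * Growth estimates *)

Lemma mprod_exp_ln (c : nat -> C) (r : R) (n : nat) : (0 <= r)%R ->
  mprod c r n = exp (rsum (fun k => ln (1 + Cmod (c k) * r)) n).
Proof.
intros Hr; induction n as [|n IH]; simpl.
- now rewrite exp_0.
- rewrite IH, exp_plus, exp_ln; [easy |].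
  pose proof (Rmult_le_pos _ _ (Cmod_ge_0 (c n)) Hr); lra.
Qed.

Lemma rsum_ln_derive (b : nat -> R) (x : R) (n : nat) :
  (forall k, (0 <= b k)%R) ->
  derivable_pt_lim (fun x => rsum (fun k => ln (1 + b k * x ^ 2))%R n) x
    (rsum (fun k => 2 * x * b k / (1 + b k * x ^ 2))%R n).
Proof.
intros Hb; induction n as [|n IH]; simpl rsum.
- apply derivable_pt_lim_const.
- apply derivable_pt_lim_plus with (1 := IH).
  assert (0 < 1 + b n * x ^ 2)%R.
  { pose proof (Rmult_le_pos _ _ (Hb n) (pow2_ge_0 x)); lra. }
  apply is_derive_Reals; auto_derive; [easy |].
  simpl; field; simpl in *; lra.
Qed.

(** Mean value theorem on [x0, r] for the logarithm of [mprod c (x ^ 2) n]: at x0 it is at most x0^2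
    S by ln (1 + u) <= u, and its slope is at most 2 ln r + 8. *)
Lemma mprod_growth (c : nat -> C) (x0 S : R) :
  (1 <= x0)%R -> (forall n, (rsum (fun k => Cmod (c k)) n <= S)%R) ->
  (forall x n, (x0 <= x)%R -> (rsum (fun k =>
       2 * x * Cmod (c k) / (1 + Cmod (c k) * x ^ 2)) n <= 2 * ln x + 8)%R) ->
  forall r n, (x0 < r)%R ->
    (mprod c (r ^ 2) n <= exp (x0 ^ 2 * S + r * (2 * ln r + 8)))%R.
Proof.
intros Hx0 HS HD r n Hr.
rewrite mprod_exp_ln by apply pow2_ge_0; apply exp_monotone.
destruct (MVT_cor2 (fun x => rsum (fun k => ln (1 + Cmod (c k) * x ^ 2)) n)
  _ x0 r Hr (fun x _ => rsum_ln_derive (fun k => Cmod (c k)) x n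
     (fun k => Cmod_ge_0 _))) as [t [E Ht]].
cbv beta in E.
assert (L : (ln t <= ln r)%R) by (apply ln_le; lra).
assert (L0 : (0 <= ln t)%R) by (rewrite <- ln_1; apply ln_le; lra).
assert (I : (rsum (fun k => ln (1 + Cmod (c k) * x0 ^ 2)) n <= x0 ^ 2 * S)%R).
{ apply Rle_trans with (2 := Rmult_le_compat_l _ _ _ (pow2_ge_0 x0) (HS n)).
  rewrite <- rsum_scal; apply rsum_le; intros k. cbv beta.
  rewrite (Rmult_comm _ (x0 ^ 2)).
  pose proof (Rmult_le_pos _ _ (pow2_ge_0 x0) (Cmod_ge_0 (c k))) as P.
  rewrite <- (ln_exp (x0 ^ 2 * Cmod (c k))) at 2.
  apply ln_le; [lra | apply exp_ineq1_le]. }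
pose proof (HD t n ltac:(lra)) as D.
assert (D' : ((2 * ln t + 8) * (r - x0) <= (2 * ln r + 8) * r)%R)
  by (apply Rmult_le_compat; lra).
apply (Rmult_le_compat_r (r - x0)) in D; lra.
Qed.

Lemma rlnr_le_Rpower (m Q : R) : (1 < m)%R -> exists M : R, (1 <= M)%R /\
  forall r, (M <= r)%R -> (Q + r * (2 * ln r + 8) <= Rpower r m)%R.
Proof.
intros Hm; set (d := (m - 1)%R); set (q := (Rabs Q + 8)%R).
assert (d0 : (0 < d)%R) by (unfold d; lra).
pose proof (Rabs_pos Q); pose proof (Rle_abs Q).
assert (q0 : (0 < q)%R) by (unfold q; lra).
assert (K : (0 < (8 + 4 * q) / d ^ 2)%R)
  by (apply Rdiv_lt_0_compat; [lra | nra]).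
(* With L = ln r, this threshold gives L d^2 >= 8 + 4 q, hence (d L)^2 / 4 >= 2 L + q L; the added 1
   gives L >= 1, so q <= q L. *)
exists (exp ((8 + 4 * q) / d ^ 2 + 1)); split.
{ pose proof (exp_ineq1_le ((8 + 4 * q) / d ^ 2 + 1)); lra. }
intros r Hr.
assert (r1 : (1 <= r)%R).
{ pose proof (exp_ineq1_le ((8 + 4 * q) / d ^ 2 + 1)); lra. }
set (L := ln r).
assert (HL : ((8 + 4 * q) / d ^ 2 + 1 <= L)%R).
{ unfold L; rewrite <- (ln_exp (_ + 1)); apply ln_le; [apply exp_pos | easy]. }
assert (E : (Rpower r m = r * exp (d * L))%R).
{ replace m with (1 + d)%R by (unfold d; ring).
  rewrite Rpower_plus, Rpower_1 by lra; reflexivity. }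
rewrite E.
(* Squaring exp (u/2) >= u/2 gives exp u >= u^2/4. *)
assert (F : (d * L * (d * L) / 4 <= exp (d * L))%R).
{ replace (d * L)%R with (d * L / 2 + d * L / 2)%R at 3 by field.
  rewrite exp_plus; pose proof (exp_ineq1_le (d * L / 2)).
  assert (0 <= d * L)%R by nra.
  apply Rle_trans with ((d * L / 2) * (d * L / 2))%R; [lra |].
  apply Rmult_le_compat; lra. }
assert (G : (2 * L + q <= d * L * (d * L) / 4)%R).
{ assert (G1 : ((8 + 4 * q) <= L * d ^ 2)%R).
  { apply Rmult_le_reg_r with (/ d ^ 2)%R; [apply Rinv_0_lt_compat; nra |].
    rewrite Rmult_assoc, Rinv_r by nra; unfold Rdiv in HL; lra. }
  apply Rmult_le_compat_l with (r := (L / 4)%R) in G1; [| lra].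
  assert (q * 1 <= q * L)%R by (apply Rmult_le_compat_l; lra).
  nra. }
assert (Q <= r * Rabs Q)%R by nra.
apply Rle_trans with (r * (2 * L + q))%R; [unfold q; lra |].
apply Rmult_le_compat_l; lra.
Qed.

Lemma exp_beats_Rpower (m K c : R) : (m < 1)%R -> (0 < c)%R ->
  exists M : R, (1 <= M)%R /\
  forall y, (M <= y)%R -> (K * exp (Rpower y m) < c * exp y)%R.
Proof.
intros Hm Hc; set (d := (1 - m)%R).
assert (d0 : (0 < d)%R) by (unfold d; lra).
pose proof (Rabs_pos K); pose proof (Rle_abs K).
set (k := (2 * Rabs K / c)%R).
assert (k0 : (0 <= k)%R).
{ unfold k, Rdiv; apply Rmult_le_pos; [lra | left; now apply Rinv_0_lt_compat]. }
(* The first bound makes y^m <= y/2, since y^d >= 1 + d ln y >= 2; the second makes c exp (y/2)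
   exceed |K|. *)
exists (Rmax (exp (1 / d)) (1 + k)); split.
{ apply Rle_trans with (2 := Rmax_r _ _); lra. }
intros y Hy.
pose proof (Rmax_l (exp (1 / d)) (1 + k)).
pose proof (Rmax_r (exp (1 / d)) (1 + k)).
assert (L : (1 / d <= ln y)%R).
{ rewrite <- (ln_exp (1 / d)); apply ln_le; [apply exp_pos | lra]. }
assert (L1 : (1 <= d * ln y)%R).
{ apply (Rmult_le_compat_l d) in L; [| lra].
  replace (d * (1 / d))%R with 1%R in L by (field; lra); easy. }
assert (P : (Rpower y m <= y / 2)%R).
{ replace m with (1 + - d)%R by (unfold d; ring).
  rewrite Rpower_plus, Rpower_1 by lra.
  apply Rmult_le_compat_l; [lra |].
  unfold Rpower; rewrite Ropp_mult_distr_l_reverse, exp_Ropp.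
  apply Rinv_le_contravar; [lra |].
  pose proof (exp_ineq1_le (d * ln y)); lra. }
replace (exp y) with (exp (y / 2) * exp (y / 2))%R
  by (rewrite <- exp_plus; f_equal; field).
apply Rle_lt_trans with (Rabs K * exp (y / 2))%R.
- apply Rle_trans with (Rabs K * exp (Rpower y m))%R.
  + apply Rmult_le_compat_r; [left; apply exp_pos | easy].
  + apply Rmult_le_compat_l; [easy | now apply exp_monotone].
- rewrite <- Rmult_assoc; apply Rmult_lt_compat_r; [apply exp_pos |].
  pose proof (exp_ineq1_le (y / 2)).
  apply Rlt_le_trans with (c * (1 + y / 2))%R.
  + assert (Rabs K = c * (k / 2))%R by (unfold k; field; lra). nra.
  + apply Rmult_le_compat_l; lra.
Qed.

(** * Real values *)

(** Products over lists, where reordering of factors is expressed by [Permutation]. *)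
Definition lprod (l : list C) : C := fold_right Cmult (RtoC 1) l.

Lemma lprod_app (l l' : list C) : lprod (l ++ l') = lprod l * lprod l'.
Proof.
unfold lprod; induction l as [|x l IH]; simpl; [ring | rewrite IH; ring].
Qed.

Lemma lprod_permutation (l l' : list C) :
  Permutation l l' -> lprod l = lprod l'.
Proof.
unfold lprod; induction 1; simpl; [easy | congruence | ring | congruence].
Qed.

Lemma Cprod_lprod (u : nat -> C) (n : nat) :
  Cprod u n = lprod (map u (seq 0 n)).
Proof.
induction n as [|n IH]; [easy |].
rewrite seq_S, map_app, lprod_app; simpl; rewrite IH.
unfold lprod; simpl; ring.
Qed.

Lemma lprod_conj (l : list C) : Cconj (lprod l) = lprod (map Cconj l).
Proof.
unfold lprod; induction l as [|x l IH]; simpl.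
- apply injective_projections; simpl; ring.
- rewrite Cmult_conj, IH; reflexivity.
Qed.

Lemma Im_eq0_of_conj (z : C) : Cconj z = z -> Im z = 0%R.
Proof. destruct z as [x y]; intros E; inversion E; simpl; lra. Qed.

Lemma count_occ_map_filter (alpha : nat -> C) (a : C) (l : list nat) :
  count_occ Ceq_dec (map alpha l) a =
  length (filter (fun n => if Ceq_dec (alpha n) a then true else false) l).
Proof.
induction l as [|n l IH]; simpl; [easy |].
destruct (Ceq_dec (alpha n) a); simpl; now rewrite IH.
Qed.

Lemma count_occ_map_conj (l : list C) (a : C) :
  count_occ Ceq_dec (map Cconj l) a = count_occ Ceq_dec l (Cconj a).
Proof.
induction l as [|x l IH]; simpl; [easy |].
destruct (Ceq_dec (Cconj x) a) as [E | E];
  destruct (Ceq_dec x (Cconj a)) as [E' | E']; rewrite IH; try easy.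
- now destruct E'; rewrite <- E, Cconj_conj.
- now destruct E; rewrite E', Cconj_conj.
Qed.

(** Turns a multiplicity over all indices into a count in an initial segment that contains every
    occurrence. *)
Lemma has_card_count (alpha : nat -> C) (a : C) (m N : nat) :
  (forall n, alpha n = a -> (n < N)%nat) ->
  has_card (fun n => alpha n = a) m ->
  count_occ Ceq_dec (map alpha (seq 0 N)) a = m.
Proof.
intros HN [l [Hl [<- E]]]; rewrite count_occ_map_filter.
apply Permutation_length, NoDup_Permutation;
  [apply NoDup_filter, seq_NoDup | easy |].
intros n; rewrite filter_In, in_seq, E.
destruct (Ceq_dec (alpha n) a) as [e | e]; [| intuition easy].
specialize (HN n e); intuition lia.
Qed.

Lemma riemann_Re_mono (alpha : nat -> C) (n m : nat) :
  riemann_sequence alpha -> (n <= m)%nat -> (Re (alpha n) <= Re (alpha m))%R.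
Proof.
intros H Hnm; induction Hnm as [|m Hnm IH]; [lra |].
apply Rle_trans with (1 := IH), riemann_mono, H.
Qed.

(* Conjugation preserves the real part, so the terms with real part at most
   Re alpha_N form a multiset stable under conjugation. *)
Lemma riemann_conj_permutation (alpha : nat -> C) (N : nat) :
  riemann_sequence alpha -> (Re (alpha N) < Re (alpha (S N)))%R ->
  Permutation (map alpha (seq 0 (S N))) (map Cconj (map alpha (seq 0 (S N)))).
Proof.
intros H HN; apply (Permutation_count_occ Ceq_dec); intros a.
rewrite count_occ_map_conj.
(* Either every occurrence of a and of its conjugate lies in the segment, and condition (b) equates
   the counts (trivially for real a), or neither value occurs there. *)
destruct (Rle_dec (Re a) (Re (alpha N))) as [Ha | Ha].
- assert (B : forall b, Re b = Re a -> forall n, alpha n = b -> (n < S N)%nat).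
  { intros b Hb n E; apply Nat.nle_gt; intros Hn.
    pose proof (riemann_Re_mono alpha (S N) n H Hn) as R1.
    rewrite E, Hb in R1; lra. }
  destruct (riemann_finite_mult alpha H a) as [m Hm].
  rewrite (has_card_count alpha a m (S N) (B a eq_refl) Hm); symmetry.
  apply has_card_count; [apply B, re_conj |].
  destruct (Req_dec (Im a) 0) as [Z | Z].
  + replace (Cconj a) with a; [easy |].
    destruct a as [x y]; simpl in Z; subst y.
    apply injective_projections; simpl; ring.
  + now apply riemann_conj_mult.
- assert (B : forall b, Re b = Re a ->
    count_occ Ceq_dec (map alpha (seq 0 (S N))) b = 0%nat).
  { intros b Hb; apply count_occ_not_In; intros I.
    apply in_map_iff in I; destruct I as [n [E I]]; apply in_seq in I.
    pose proof (riemann_Re_mono alpha n N H ltac:(lia)) as R1.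
    rewrite E, Hb in R1; lra. }
  rewrite !B; auto using re_conj.
Qed.

(** Without a jump the real parts stay below r = Re alpha_N; then |alpha_k|^2 <= 2 r^2 by condition
    (d), and the |c_k| are bounded below, against summability. *)
Lemma riemann_Re_jump (alpha : nat -> C) (N : nat) : riemann_sequence alpha ->
  exists n, (N <= n)%nat /\ (Re (alpha n) < Re (alpha (S n)))%R.
Proof.
intros H; apply NNPP; intros Hn.
assert (K : forall n, (Re (alpha n) <= Re (alpha N))%R).
{ intros n; destruct (Nat.le_gt_cases n N) as [L | L];
    [now apply riemann_Re_mono |].
  induction L as [|n L IH].
  - apply Rnot_lt_le; intros L; apply Hn; now exists N.
  - apply Rle_trans with (2 := IH), Rnot_lt_le; intros L'.
    apply Hn; exists n; split; [lia | easy]. }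
destruct (riemann_summable alpha H) as [M HM].
set (r := Re (alpha N)) in *.
assert (Hr : (1 < r)%R) by apply (riemann_Re_gt1 alpha N H).
assert (T : forall k, (/ (2 * r ^ 2) <= Cmod (xi_c alpha k))%R).
{ intros k; rewrite Cmod_xi_c by now apply riemann_neq0.
  pose proof (riemann_Cmod_gt1 alpha k H).
  apply Rinv_le_contravar; [nra |]; rewrite Cmod2_alt.
  pose proof (riemann_arg alpha H k) as A; specialize (K k).
  pose proof (Rabs_pos (Im (alpha k))).
  rewrite <- (pow2_abs (Im (alpha k))); nra. }
assert (U : forall n, (INR n * / (2 * r ^ 2) <= M)%R).
{ intros n; apply Rle_trans with (2 := HM n).
  induction n as [|n IH]; [simpl; lra |].
  rewrite S_INR; simpl rsum; specialize (T n); lra. }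
destruct (INR_unbounded (M * (2 * r ^ 2))) as [n Ln].
specialize (U n); apply (Rmult_le_compat_r (2 * r ^ 2)) in U; [| nra].
rewrite Rmult_assoc, Rinv_l in U by nra; lra.
Qed.

(** As w is real, conjugating the product amounts to conjugating the alpha_k, which only permutes
    the factors. *)
Lemma pprod_real (alpha : nat -> C) (w : R) (N : nat) :
  riemann_sequence alpha -> (Re (alpha N) < Re (alpha (S N)))%R ->
  Im (pprod (xi_c alpha) w (S N)) = 0%R.
Proof.
intros H HN; apply Im_eq0_of_conj.
unfold pprod; rewrite Cprod_lprod, lprod_conj, map_map.
set (f := fun a : C => 1 + - / a ^ 2 * w).
rewrite <- (map_map alpha f).
rewrite (map_ext_in _ (fun k => f (Cconj (alpha k)))).
- rewrite <- (map_map alpha (fun a => f (Cconj a))), <- (map_map Cconj f).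
  apply lprod_permutation, Permutation_map, Permutation_sym.
  now apply riemann_conj_permutation.
- intros k _; unfold f, xi_c.
  rewrite Cplus_conj, Cmult_conj, Copp_conj, Cinv_conj, Cpow_conj.
  + f_equal; [| f_equal]; apply injective_projections; simpl; ring.
  + now apply Cpow_nz, riemann_neq0.
Qed.

(** Jumps occur arbitrarily far, so real partial products come within |Im l| of the limit l, which
    is impossible unless Im l = 0. *)
Lemma iprod_real (alpha : nat -> C) (w : R) :
  riemann_sequence alpha -> Im (iprod (xi_c alpha) w) = 0%R.
Proof.
intros H; pose proof (pprod_cv _ w (riemann_summable alpha H)) as L.
set (l := iprod _ _) in *.
destruct (Req_dec (Im l) 0) as [Z | Z]; [easy |].
destruct (L (Rabs (Im l)) (Rabs_pos_lt _ Z)) as [N HN].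
destruct (riemann_Re_jump alpha N H) as [n [Hn J]].
specialize (HN (S n) ltac:(lia)).
apply Rlt_not_le in HN; destruct HN.
apply Rle_trans with (2 := Rmax_Cmod _).
apply Rle_trans with (2 := Rmax_r _ _).
change (snd _) with (Im (pprod (xi_c alpha) w (S n)) + - Im l)%R.
rewrite pprod_real by easy; rewrite Rplus_0_l, Rabs_Ropp; lra.
Qed.

(** * Properties of Xi *)

Lemma entire_const (a : C) : entire (fun _ => a).
Proof. intros z; apply (ex_derive_const (K := C_AbsRing)). Qed.

(* C carries two uniform structures, the product one and the one induced by
   Cmod; derivatives agree because they only depend on the norm. *)
Lemma is_derive_C_AbsRing (f : C -> C) (z l : C) :
  is_derive (K := C_AbsRing) (V := C_NormedModule) f z l <->
  is_derive (K := C_AbsRing) (V := AbsRing_NormedModule C_AbsRing) f z l.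
Proof.
split; intros [_ D]; (split; [| exact D]).
- exact (is_linear_scal_l (K := C_AbsRing)
    (V := AbsRing_NormedModule C_AbsRing) l).
- exact (is_linear_scal_l (K := C_AbsRing) (V := C_NormedModule) l).
Qed.

Lemma entire_id : entire (fun z => z).
Proof.
intros z; exists (RtoC 1); apply is_derive_C_AbsRing.
exact (is_derive_id (K := C_AbsRing) z).
Qed.

Lemma entire_plus (f g : C -> C) :
  entire f -> entire g -> entire (fun z => f z + g z).
Proof.
intros Hf Hg z.
exact (ex_derive_plus (K := C_AbsRing) (V := C_NormedModule) f g z (Hf z) (Hg z)).
Qed.

Lemma entire_mult (f g : C -> C) :
  entire f -> entire g -> entire (fun z => f z * g z).
Proof.
intros Hf Hg z; destruct (Hf z) as [df Df]; destruct (Hg z) as [dg Dg].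
apply is_derive_C_AbsRing in Df, Dg.
eexists; apply is_derive_C_AbsRing.
exact (is_derive_mult (K := C_AbsRing) f g z df dg Df Dg Cmult_comm).
Qed.

Lemma entire_comp (f g : C -> C) :
  entire f -> entire g -> entire (fun z => f (g z)).
Proof.
intros Hf Hg z; destruct (Hf (g z)) as [df Df]; destruct (Hg z) as [dg Dg].
apply is_derive_C_AbsRing in Dg.
eexists; exact (is_derive_comp (K := C_AbsRing) (V := C_NormedModule)
  f g z df dg Df Dg).
Qed.

Lemma entire_pow (f : C -> C) (n : nat) :
  entire f -> entire (fun z => f z ^ n).
Proof.
intros Hf; induction n as [|n IH]; [exact (entire_const 1) |].
exact (entire_mult f (fun z => f z ^ n) Hf IH).
Qed.

Lemma entire_iprod_sqr (c : nat -> C) : summable c ->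
  entire (fun z => iprod c (z ^ 2)).
Proof.
intros Hc; apply (entire_comp (iprod c)).
- intros w; now apply iprod_ex_derive.
- apply entire_pow, entire_id.
Qed.

Lemma entire_ext (f g : C -> C) :
  (forall z, f z = g z) -> entire f -> entire g.
Proof.
intros E Hf z.
exact (ex_derive_ext (K := C_AbsRing) (V := C_NormedModule) f g z E (Hf z)).
Qed.

(** * The product formula and the zeros of Xi *)

Lemma Cprod_ext (u v : nat -> C) (n : nat) :
  (forall k, u k = v k) -> Cprod u n = Cprod v n.
Proof. intros E; induction n as [|n IH]; simpl; congruence. Qed.

Lemma Cprod_xi_factor (alpha : nat -> C) (t : C) (n : nat) :
  Cprod (xi_factor alpha t) n = pprod (xi_c alpha) (t ^ 2) n.
Proof.
apply Cprod_ext; intros k; unfold xi_factor, xi_c, Cdiv; ring.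
Qed.

Lemma Cprod_xi_cv (alpha : nat -> C) (t : C) : riemann_sequence alpha ->
  Cseq_lim (Cprod (xi_factor alpha t)) (iprod (xi_c alpha) (t ^ 2)).
Proof.
intros H; apply Cseq_lim_eventually_eq
  with (u := pprod (xi_c alpha) (t ^ 2)) (N := 0%nat).
- intros n _; now rewrite Cprod_xi_factor.
- now apply pprod_cv, riemann_summable.
Qed.

Lemma XiE (alpha : nat -> C) (t : C) : riemann_sequence alpha ->
  Xi alpha t = Xi0 alpha * iprod (xi_c alpha) (t ^ 2).
Proof.
intros H; unfold Xi; now rewrite (Clim_seq_unique _ _ (Cprod_xi_cv alpha t H)).
Qed.

Lemma Xi0_gt0 (alpha : nat -> C) : (0 < Xi0 alpha)%R.
Proof. apply exp_pos. Qed.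

Lemma Xi0_neq0 (alpha : nat -> C) : RtoC (Xi0 alpha) <> 0.
Proof.
intros E; apply RtoC_inj in E; pose proof (Xi0_gt0 alpha); lra.
Qed.

Lemma Csqr_eq (a t : C) : a ^ 2 = t ^ 2 -> t = a \/ t = - a.
Proof.
intros E; destruct (Ceq_dec t a) as [-> | N]; [now left | right].
assert (P : (t - a) * (t + a) = 0).
{ replace ((t - a) * (t + a)) with (t ^ 2 - a ^ 2) by ring; rewrite E; ring. }
apply NNPP; intros N'; apply (Cmult_neq_0 (t - a) (t + a)); [| | exact P].
- intros Z; apply N; replace t with ((t - a) + a) by ring; rewrite Z; ring.
- intros Z; apply N'; replace t with ((t + a) - a) by ring; rewrite Z; ring.
Qed.

Lemma xi_factor_eq0 (alpha : nat -> C) (t : C) (k : nat) :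
  riemann_sequence alpha ->
  1 + xi_c alpha k * t ^ 2 = 0 <-> t = alpha k \/ t = - alpha k.
Proof.
intros H; pose proof (riemann_neq0 alpha k H) as A.
unfold xi_c; split.
- intros E; apply Csqr_eq.
  replace (alpha k ^ 2) with ((1 + - / alpha k ^ 2 * t ^ 2) * alpha k ^ 2 + t ^ 2)
    by (field; easy).
  rewrite E; ring.
- intros [-> | ->]; field; easy.
Qed.

Lemma Xi_eq0 (alpha : nat -> C) (t : C) : riemann_sequence alpha ->
  Xi alpha t = 0 <-> exists n : nat, t = alpha n \/ t = - alpha n.
Proof.
intros H; pose proof (riemann_summable alpha H) as Hc; rewrite XiE by easy.
split.
- intros E; apply NNPP; intros N.
  apply (Cmult_neq_0 (Xi0 alpha) (iprod (xi_c alpha) (t ^ 2)));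
    [apply Xi0_neq0 | | exact E].
  apply iprod_neq0; [easy |]; intros k Z; apply N; exists k.
  now apply xi_factor_eq0.
- intros [n Hn]; rewrite (iprod_drop _ _ n Hc).
  apply xi_factor_eq0 in Hn; [rewrite Hn; ring | easy].
Qed.

(** The m factors vanishing at a all equal 1 - z^2/a^2 = (z - a) (-(z + a)/a^2); the remaining
    product has no factor vanishing at a. *)
Lemma Xi_zero_multiplicity (alpha : nat -> C) (a : C) (m : nat) :
  riemann_sequence alpha ->
  has_card (fun n => a = alpha n \/ a = - alpha n) m ->
  zero_multiplicity (Xi alpha) a m.
Proof.
intros H [l [Hl [Hm E]]].
pose proof (riemann_summable alpha H) as Hc.
assert (Ha : forall j, In j l -> xi_c alpha j = - / a ^ 2 /\ a <> 0).
{ intros j Hj; apply E in Hj; pose proof (riemann_neq0 alpha j H) as A.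
  unfold xi_c; destruct Hj as [-> | ->]; split; auto.
  - do 2 f_equal; ring.
  - intros Z; apply A; replace (alpha j) with (- - alpha j) by ring.
    rewrite Z; ring. }
(* The point a = 0 is allowed only with m = 0, when the powers containing [/ a ^ 2] are 1. *)
assert (Hm0 : m = 0%nat \/ a <> 0).
{ destruct l as [|j l']; [now left | right; apply (Ha j); now left]. }
exists (fun z => Xi0 alpha * ((- / a ^ 2 * (z + a)) ^ m
   * iprod (drops (xi_c alpha) l) (z ^ 2))).
split; [| split].
- apply (entire_mult (fun _ => Xi0 alpha)); [apply entire_const |].
  apply (entire_mult (fun z => (- / a ^ 2 * (z + a)) ^ m)).
  + apply entire_pow, (entire_mult (fun _ => - / a ^ 2)).
    * apply entire_const.
    * apply entire_plus; [apply entire_id | apply entire_const].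
  + now apply entire_iprod_sqr, summable_drops.
- apply Cmult_neq_0; [apply Xi0_neq0 |].
  apply Cmult_neq_0.
  + destruct Hm0 as [-> | Ha0]; [apply C1_nz | apply Cpow_nz].
    replace (- / a ^ 2 * (a + a)) with (- (2) * / a) by (field; easy).
    apply Cmult_neq_0.
    * intros Z; apply (f_equal Re) in Z; simpl in Z; lra.
    * intros Z; apply C1_nz; rewrite <- (Cinv_r a Ha0), Z; ring.
  + apply iprod_neq0; [now apply summable_drops |]; intros k.
    destruct (in_dec Nat.eq_dec k l) as [I | I].
    * rewrite drops_in by now left.
      replace (1 + 0 * a ^ 2) with (RtoC 1) by ring; apply C1_nz.
    * rewrite drops_notin by easy; intros Z; apply I, E.
      now apply xi_factor_eq0.
- intros z; rewrite XiE by easy.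
  rewrite (iprod_drops _ (- / a ^ 2) _ l Hc Hl) by (intros j Hj; now apply Ha).
  rewrite Hm.
  replace ((1 + - / a ^ 2 * z ^ 2) ^ m)
    with ((z - a) ^ m * (- / a ^ 2 * (z + a)) ^ m); [ring |].
  rewrite <- Cpow_mult_l; destruct Hm0 as [-> | Ha0]; [easy |].
  f_equal; field; easy.
Qed.

(** * The order of Xi *)

Lemma Xi_exp_growth (alpha : nat -> C) (m : R) : riemann_sequence alpha ->
  (1 < m)%R -> exp_growth (Xi alpha) m.
Proof.
intros H Hm; destruct (riemann_bounds alpha H) as [x0 [Hx0 B]].
destruct (riemann_summable alpha H) as [S HS].
destruct (rlnr_le_Rpower m (x0 ^ 2 * S) Hm) as [M [HM1 HM]].
(* Since M >= 1, the radius M + x0 exceeds x0 strictly, as [mprod_growth] demands. *)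
exists (Xi0 alpha), (M + x0)%R; split; [lra |]; intros z Hz.
pose proof (Xi0_gt0 alpha).
rewrite XiE, Cmod_mult, Cmod_R, Rabs_pos_eq by (easy || lra).
apply Rmult_le_compat_l; [lra |].
apply (Cseq_lim_Cmod_le (pprod (xi_c alpha) (z ^ 2)) _ _ 0);
  [| apply pprod_cv; now exists S].
intros n _.
apply Rle_trans with (mprod (xi_c alpha) (Cmod z ^ 2) n).
- apply pprod_le_mprod; rewrite Cmod_pow; lra.
- apply Rle_trans with (1 := mprod_growth _ x0 S Hx0 HS
    (fun x n Hx => proj1 (B x Hx) n) (Cmod z) n ltac:(lra)).
  apply exp_monotone, HM; lra.
Qed.

(** At t = iy the modulus is at least [Xi0 alpha] times exp y for large y, which outgrows K exp
    (y^m) when m < 1. *)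
Lemma Xi_exp_growth_ge1 (alpha : nat -> C) (m : R) : riemann_sequence alpha ->
  exp_growth (Xi alpha) m -> (1 <= m)%R.
Proof.
intros H [K [M [HM G]]]; apply Rnot_lt_le; intros Hm.
destruct (riemann_bounds alpha H) as [x0 [Hx0 B]].
pose proof (Xi0_gt0 alpha) as X0; pose proof PI_RGT_0 as P0.
destruct (exp_beats_Rpower m K (Xi0 alpha) Hm X0) as [M' [HM' G']].
(* From ln (y / (2 PI)) >= 12 comes (1/2) 12 - 2 = 4, which cancels the 4 in y/4. *)
set (y := (M + x0 + M' + 2 * PI * exp 12)%R).
assert (Y0 : (2 * PI * exp 12 <= y)%R) by (unfold y; lra).
assert (Y1 : (0 < 2 * PI * exp 12)%R)
  by (pose proof (exp_pos 12); nra).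
assert (Y2 : (12 <= ln (y / (2 * PI)))%R).
{ rewrite <- (ln_exp 12); apply ln_le; [apply exp_pos |].
  apply Rmult_le_reg_r with (2 * PI)%R; [lra |].
  unfold Rdiv; rewrite (Rmult_assoc y), Rinv_l by lra; lra. }
assert (My : (M <= y)%R) by (unfold y; lra).
assert (My' : (M' <= y)%R) by (unfold y; lra).
assert (Xy : (x0 <= y)%R) by (unfold y; lra).
clearbody y.
assert (Cy : Cmod (Ci * y) = y).
{ rewrite Cmod_mult, Cmod_Ci, Cmod_R, Rabs_pos_eq; lra. }
specialize (G (Ci * y)); rewrite Cy in G; specialize (G My).
specialize (G' y My').
apply Rlt_not_le with (1 := G'); apply Rle_trans with (2 := G).
rewrite XiE, Cmod_mult, Cmod_R, Rabs_pos_eq by (easy || lra).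
apply Rmult_le_compat_l; [lra |].
apply Rle_trans with (exp (y / 4 * (1 / 2 * ln (y / (2 * PI)) - 2))).
- apply exp_monotone; nra.
- apply (proj2 (B y Xy)).
  apply Cseq_lim_eventually_eq
    with (2 := Cprod_xi_cv alpha (Ci * y) H) (N := 0%nat).
  intros n _; apply Cprod_ext; intros k; unfold xi_factor, Cdiv.
  replace ((Ci * y) ^ 2) with (- y ^ 2); [ring |].
  apply injective_projections; simpl; ring.
Qed.

(** Every m > 1 is admissible and no m < 1 is, so the infimum is 1 whether or not it is attained. *)
Lemma Xi_order (alpha : nat -> C) : riemann_sequence alpha ->
  entire_order (Xi alpha) = Finite 1.
Proof.
intros H; apply is_glb_Rbar_unique; split.
- intros m [_ Hm]; now apply (Xi_exp_growth_ge1 alpha).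
- intros b Hb.
  assert (L : forall m : R, (1 < m)%R -> Rbar_le b m).
  { intros m Hm; apply Hb; split; [lra | now apply Xi_exp_growth]. }
  destruct b as [b | |]; simpl in *.
  + apply le_epsilon; intros e He; apply L; lra.
  + apply (L 2%R); lra.
  + easy.
Qed.

Theorem theorem19 (alpha : nat -> C) (h_riemann : riemann_sequence alpha) :
  (forall t : C, exists l : C,
     filterlim (Cprod (xi_factor alpha t)) eventually
       (locally (T := C_UniformSpace) l)) /\
  (forall t : C, Xi alpha (- t) = Xi alpha t) /\
  entire (Xi alpha) /\
  entire_order (Xi alpha) = Finite 1 /\
  (forall t : C, Xi alpha t = 0 <->
     exists n : nat, t = alpha n \/ t = - alpha n) /\
  (forall (t : C) (m : nat),
     has_card (fun n => t = alpha n \/ t = - alpha n) m ->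
     zero_multiplicity (Xi alpha) t m) /\
  (forall x : R, Im (Xi alpha (RtoC x)) = 0%R) /\
  (forall y : R, Im (Xi alpha (Ci * RtoC y)) = 0%R).
Proof.
(* Real and purely imaginary arguments are treated together: both have a real square. *)
assert (R1 : forall (w : C) (x : R), w ^ 2 = RtoC x -> Im (Xi alpha w) = 0%R).
{ intros w x E; rewrite XiE, E by easy.
  transitivity (Xi0 alpha * Im (iprod (xi_c alpha) x))%R;
    [| rewrite iprod_real by easy; ring].
  unfold Im; simpl; ring. }
split; [| split; [| split; [| split; [| split; [| split; [| split]]]]]].
- intros t; exists (iprod (xi_c alpha) (t ^ 2)).
  now apply Cseq_limE, Cprod_xi_cv.
- intros t; rewrite !XiE by easy; do 2 f_equal; ring.
- apply (entire_ext (fun t => Xi0 alpha * iprod (xi_c alpha) (t ^ 2))).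
  + intros t; now rewrite XiE.
  + apply (entire_mult (fun _ => Xi0 alpha)); [apply entire_const |].
    now apply entire_iprod_sqr, riemann_summable.
- now apply Xi_order.
- intros t; now apply Xi_eq0.
- intros t m; now apply Xi_zero_multiplicity.
- intros x; apply (R1 _ (x ^ 2)%R); now rewrite RtoC_pow.
- intros y; apply (R1 _ (- y ^ 2)%R).
  apply injective_projections; simpl; ring.
Qed.
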